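(* Let $X$ be a smooth manifold and $G$ a Lie group with a smooth, free and proper (left) action on $X$, and let $\pi\colon X\to X/G$ be the quotient map. Then $(X,\pi,X/G,G)$ is a smooth principal $G$-bundle: every $G\cdot x\in X/G$ has an open neighborhood $V$ and a diffeomorphism $\psi\colon\pi^{-1}(V)\to G\times V$ of the form $\psi(x')=(\chi(x'),\pi(x'))$ such that $\psi(g\cdot x')=(g\,\chi(x'),\pi(x'))$ for all $g\in G$ and $x'\in\pi^{-1}(V)$.
   Context: Smooth manifolds are Hausdorff and second countable. A continuous action is proper if the map $G\times X\to X\times X$, $(g,x)\mapsto(g\cdot x,x)$, is proper (for manifolds: preimages of compact sets are compact). The orbit space $X/G$, with the quotient topology, carries the unique smooth manifold structure for which $\pi\colon X\to X/G$ is a smooth submersion (it exists by the Quotient Manifold Theorem). *)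

(* Defs.v *)
From HB Require Import structures.
From mathcomp Require Import all_boot all_order all_algebra.
From mathcomp Require Import all_classical all_reals all_analysis.
Set Implicit Arguments.
Unset Strict Implicit.
Unset Printing Implicit Defensive.
Import Order.TTheory GRing.Theory Num.Theory.
Import numFieldNormedType.Exports.
Local Open Scope classical_set_scope.
Local Open Scope ring_scope.

(* [differentiable_order k U f] says that [f] is of class C^k on [U]. Here and
   below, functions on an open set [U] are total functions whose values outside
   [U] are irrelevant; the definitions are only meant for open [U]. *)

Fixpoint differentiable_order (R : realType) (V W : normedModType R) (k : nat)
    (U : set V) (f : V -> W) : Prop :=
  match k with
  | 0 => forall x, U x -> {for x, continuous f}
  | k'.+1 => (forall x, U x -> differentiable f x) /\
             forall v : V, differentiable_order k' U ('D_v f)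
  end.

Definition smooth_on (R : realType) (V W : normedModType R)
    (U : set V) (f : V -> W) : Prop :=
  forall k, differentiable_order k U f.

(* A chart is a homeomorphism between the open sets [chart_dom] and
   [chart_fun @` chart_dom]; both functions are junk elsewhere. These
   requirements are stated in [is_chart]. *)
Record chart (R : realType) (n : nat) (M : Type) := Chart {
  chart_dom : set M ;
  chart_fun :> M -> 'rV[R]_n ;
  chart_inv : 'rV[R]_n -> M }.

Definition is_chart (R : realType) n (M : topologicalType) (c : chart R n M) :=
  [/\ open (chart_dom c),
      open (c @` chart_dom c),
      forall x, chart_dom c x -> chart_inv c (c x) = x,
      forall x, chart_dom c x -> {for x, continuous c} &
      forall v, (c @` chart_dom c) v -> {for v, continuous (chart_inv c)}].

Definition is_smooth_atlas (R : realType) n (M : topologicalType)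
    (A : set (chart R n M)) : Prop :=
  [/\ forall c, A c -> is_chart c,
      forall x, exists2 c, A c & chart_dom c x &
      forall c d, A c -> A d ->
        smooth_on (c @` (chart_dom c `&` chart_dom d)) (d \o chart_inv c)].

(* The atlas is not required to be maximal: it stands for the smooth structure
   that it generates. *)
Definition smooth_manifold (R : realType) n (M : topologicalType)
    (A : set (chart R n M)) : Prop :=
  [/\ hausdorff_space M, @second_countable M & is_smooth_atlas A].

Definition prod_chart (R : realType) n p (M N : Type)
    (c : chart R n M) (d : chart R p N) : chart R (n + p) (M * N) :=
  Chart (chart_dom c `*` chart_dom d)
        (fun z => row_mx (c z.1) (d z.2))
        (fun v => (chart_inv c (lsubmx v), chart_inv d (rsubmx v))).

Definition prod_atlas (R : realType) n p (M N : Type)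
    (A : set (chart R n M)) (B : set (chart R p N)) :
    set (chart R (n + p) (M * N)) :=
  [set e | exists c d, [/\ A c, B d & e = prod_chart c d]].

Definition chart_rep (R : realType) n p (M N : Type)
    (c : chart R n M) (d : chart R p N) (f : M -> N) : 'rV[R]_n -> 'rV[R]_p :=
  d \o f \o chart_inv c.

Definition smooth_map_on (R : realType) n p (M N : topologicalType)
    (A : set (chart R n M)) (B : set (chart R p N))
    (U : set M) (f : M -> N) : Prop :=
  (forall x, U x -> {for x, continuous f}) /\
  forall c d, A c -> B d ->
    smooth_on (c @` (U `&` chart_dom c `&` f @^-1` chart_dom d))
              (chart_rep c d f).

Definition smooth_map (R : realType) n p (M N : topologicalType)
    (A : set (chart R n M)) (B : set (chart R p N)) (f : M -> N) : Prop :=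
  smooth_map_on A B setT f.

(* The last clause is the surjectivity of the differential of [f] at [x], read
   in the charts [c] and [d]. *)
Definition smooth_submersion (R : realType) n p (M N : topologicalType)
    (A : set (chart R n M)) (B : set (chart R p N)) (f : M -> N) : Prop :=
  smooth_map A B f /\
  forall x c d, A c -> B d -> chart_dom c x -> chart_dom d (f x) ->
    forall w, exists v, 'd (chart_rep c d f) (c x) v = w.

Definition diffeomorphism_on (R : realType) n p (M N : topologicalType)
    (A : set (chart R n M)) (B : set (chart R p N))
    (U : set M) (W : set N) (f : M -> N) : Prop :=
  smooth_map_on A B U f /\
  exists g : N -> M,
    [/\ smooth_map_on B A W g,
        forall x, U x -> W (f x), forall y, W y -> U (g y),
        forall x, U x -> g (f x) = x & forall y, W y -> f (g y) = y].

(* No compatibility is required here; it is part of [lie_group]. *)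
#[short(type="groupTopologicalType")]
HB.structure Definition GroupTopological :=
  {G of Group G & Topological G}.

Definition lie_group (R : realType) n (G : groupTopologicalType)
    (A : set (chart R n G)) : Prop :=
  [/\ smooth_manifold A,
      smooth_map (prod_atlas A A) A (fun z : G * G => (z.1 * z.2)%g) &
      smooth_map A A (fun g : G => (g^-1)%g)].

Record left_action (G : groupType) (X : Type) := LeftAction {
  act :> G -> X -> X ;
  act1 : forall x, act 1%g x = x ;
  actM : forall g h x, act (g * h)%g x = act g (act h x) }.

Definition free_action (G : groupType) X (a : left_action G X) : Prop :=
  forall g x, a g x = x -> g = 1%g.

Definition proper_map (T U : topologicalType) (f : T -> U) : Prop :=
  continuous f /\ forall K, compact K -> compact (f @^-1` K).

Definition proper_action (G : groupTopologicalType) (X : topologicalType)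
    (a : left_action G X) : Prop :=
  proper_map (fun z : G * X => (a z.1 z.2, z.2)).

Definition smooth_action (R : realType) n p (G : groupTopologicalType)
    (X : topologicalType) (AG : set (chart R n G)) (AX : set (chart R p X))
    (a : left_action G X) : Prop :=
  smooth_map (prod_atlas AG AX) AX (fun z : G * X => a z.1 z.2).

Section OrbitSpace.
Variables (G : groupType) (X : topologicalType) (a : left_action G X).

Definition orbit_rel (x y : X) : bool := `[< exists g, a g x = y >].

Lemma orbit_rel_refl : reflexive orbit_rel.
Proof. by move=> x; apply/asboolP; exists 1%g; rewrite act1. Qed.

Lemma orbit_rel_sym : symmetric orbit_rel.
Proof.
by move=> x y; apply/asboolP/asboolP => -[g <-]; exists g^-1%g;
  rewrite -actM mulVg act1.
Qed.

Lemma orbit_rel_trans : transitive orbit_rel.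
Proof.
move=> y x z /asboolP[g <-] /asboolP[h <-]; apply/asboolP.
by exists (h * g)%g; rewrite actM.
Qed.

Definition orbit_equiv : equiv_rel X :=
  EquivRel orbit_rel orbit_rel_refl orbit_rel_sym orbit_rel_trans.

(* Its open sets are those whose preimage under [orbit_proj] is open in [X]. *)
Definition orbit_space : topologicalType :=
  quotient_topology {eq_quot orbit_equiv}%qT.

Definition orbit_proj : X -> orbit_space :=
  \pi_(quotient_topology {eq_quot orbit_equiv}%qT)%qT.

End OrbitSpace.

(* Main.v *)
(** Near [x] take a smooth local section [s] of the submersion [pi] through [x]
    and put [phi (g, y) = a g (s y)]: over the domain of [s] this is an
    equivariant bijection, and a trivialization is its inverse [(chi, pi)].

    The map [phi] is an immersion at [(1, pi x)]. Indeed [pi \o phi] is the second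
    projection, so only the orbit map [g |-> a g x] matters; it has constant rank
    by equivariance and is injective by freeness, and an injective map of
    constant rank is an immersion. Composing [phi] in charts with a left inverse
    of its Jacobian gives a map to which the inverse function theorem applies,
    and its local inverse recovers [(chi x', pi x')] from [x'] as soon as
    [chi x'] is close to [1]; this holds for [x'] close to [x] because the action
    is proper. Hence [chi] is smooth near [x], without any dimension count, and
    [chi (a g x') = g * chi x'] carries smoothness along the orbits. *)

Require Import Defs.
From HB Require Import structures.
From mathcomp Require Import all_boot all_order all_algebra perm.
From mathcomp Require Import all_classical all_reals all_analysis ring lra.
Set Implicit Arguments.
Unset Strict Implicit.
Unset Printing Implicit Defensive.
Import Order.TTheory GRing.Theory Num.Theory.
Import numFieldNormedType.Exports.
Local Open Scope classical_set_scope.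
Local Open Scope ring_scope.

(** * Functions of class C^k on open sets *)

(** Freeness is a statement about points, an immersion one about tangent vectors; the constant rank
    argument joins the two without one-parameter subgroups or an exponential map. A left inverse of
    the Jacobian of [phi] is enough because algebra alone shows that [phi] hits every point over the
    domain of [s]: the inverse function theorem yields a smooth map on a neighborhood of [x] in a
    chart of [X], and near [x] this map must agree with the algebraically defined [chi]. Properness
    acts through the pair [s (pi x')], [x']: both tend to [x], so the element [chi x'] that moves
    the first to the second is confined to a neighborhood of [1]. To reach whole orbits the base is
    shrunk until each orbit over it passes, at [s y], through the region where [chi] is already
    smooth. Since values outside domains are arbitrary, most identities hold near a point only;
    hence the manifold level works with germs and carries continuity alongside smoothness of
    representatives. *)

Section Differentials.
Variables (R : realType) (V W : normedModType R).
Implicit Types (f g : V -> W).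

Lemma differentiable_near f x : differentiable f x ->
  forall e, 0 < e -> \forall y \near x, `|f y - f x - 'd f x (y - x)| <= e * `|y - x|.
Proof.
move=> /diff_locally /eqaddoP H e /H {}H.
rewrite (near_shift 0) subr0.
apply: filterS H => h /=.
by rewrite addrK opprD addrA.
Qed.

(** The epsilon form suits a differential guessed in advance, such as that of a local inverse;
    [diff_unique] identifies it. *)
Lemma is_diff_near f x (L : {linear V -> W}) : continuous L ->
  (forall e, 0 < e ->
     \forall y \near x, `|f y - f x - L (y - x)| <= e * `|y - x|) ->
  is_diff x f L.
Proof.
move=> cL H.
have fE : f \o shift x = cst (f x) + L +o_ 0 id.
  apply/eqaddoP => e /H; rewrite (near_shift 0) subr0 => {}H.
  apply: filterS H => h /=.
  by rewrite addrK opprD addrA.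
have dE := diff_unique cL fE.
by apply: DiffDef => //; apply/diff_locallyP; rewrite dE.
Qed.

Lemma near_eq_is_diff f g x : {near x, f =1 g} -> differentiable f x ->
  is_diff x g ('d f x).
Proof.
move=> fg df; apply: is_diff_near; first exact: diff_continuous.
move=> e e0; have := differentiable_near df e0.
by apply: filterS2 (fg) => y fgy; rewrite fgy (nbhs_singleton fg).
Qed.

(** Scalar multiplication is packed as a continuous bilinear map, whose differential is composed
    with that of the pair [(s, f)]. *)
Lemma is_diff_scale (s : V -> R) f x : differentiable s x -> differentiable f x ->
  is_diff x (fun y => s y *: f y) (fun v => s x *: 'd f x v + 'd s x v *: f x).
Proof.
move=> ds df.
have bl : bilinear_for (GRing.Scale.Law.clone _ _ *:%R _)
    (GRing.Scale.Law.clone _ _ *:%R _) (@GRing.scale R W).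
  by split=> [u|u] b y z /=; [rewrite scalerDl scalerA|
    rewrite scalerDr !scalerA mulrC].
pose B : {bilinear R -> W -> W} :=
  HB.pack (@GRing.scale R W) (bilinear_isBilinear.Build _ _ _ _ _ _ _ bl).
have cB : continuous (fun p : R * W => B p.1 p.2).
  by move=> p; exact: scale_continuous.
have dsf := differentiable_pair ds df.
have -> : (fun y => s y *: f y) =
  (fun p : R * W => B p.1 p.2) \o (fun y => (s y, f y)) by [].
have dB := @differentiable_bilin _ _ _ _ B (s x, f x) cB.
apply: DiffDef; first exact: differentiable_comp.
by rewrite diff_comp // diff_pair // (diff_bilin _ cB).
Qed.

End Differentials.

Section DifferentiableOrder.
Variables (R : realType) (V W : normedModType R).
Implicit Types (U : set V) (f g : V -> W).

Lemma differentiable_order_sub k U U' f : U' `<=` U ->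
  differentiable_order k U f -> differentiable_order k U' f.
Proof.
elim: k f => [|k IH] f UU' /=; first by move=> H x /UU' /H.
by case=> df H; split => [x /UU' /df //|v]; exact: IH.
Qed.

Lemma differentiable_order_local k U f :
  (forall x, U x -> exists2 W, W x & differentiable_order k W f) ->
  differentiable_order k U f.
Proof.
elim: k f => [|k IH] f H /=; first by move=> x /H[Y Yx /(_ _ Yx)].
split=> [x /H[Y Yx [dY _]]|v]; first exact: dY.
by apply: IH => x /H[Y Yx [_ HY]]; exists Y => //; exact: HY.
Qed.

(** Openness turns equality on [U] into equality of germs, which derivatives respect. The closure
    lemmas below use it to replace a derivative by a formula valid on [U] only. *)
Lemma differentiable_order_eq k U f g : open U ->
  (forall x, U x -> f x = g x) ->
  differentiable_order k U f -> differentiable_order k U g.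
Proof.
move=> oU; elim: k f g => [|k IH] f g fg.
  move=> cf x Ux; have nfg : {near x, f =1 g}.
    by near=> y; apply: fg; near: y; exact: open_nbhs_nbhs.
  rewrite /prop_for /continuous_at -(fg _ Ux).
  exact: cvg_trans (near_eq_cvg nfg) (cf x Ux).
case=> df dDf; split=> [x Ux|v].
  have nfg : {near x, f =1 g}.
    by near=> y; apply: fg; near: y; exact: open_nbhs_nbhs.
  by case: (near_eq_is_diff nfg (df x Ux)).
apply: (IH ('D_v f)) (dDf v) => x Ux.
apply: near_eq_derive.
by near=> y; apply: fg; near: y; exact: open_nbhs_nbhs.
Unshelve. all: by end_near. Qed.

Lemma differentiable_orderW k U f :
  differentiable_order k.+1 U f -> differentiable_order k U f.
Proof.
elim: k f => [|k IH] f [df dDf] /=.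
  by move=> x /df; exact: differentiable_continuous.
by split=> // v; apply: IH.
Qed.

Lemma differentiable_order_cst k U (w : W) : differentiable_order k U (cst w).
Proof.
elim: k w => [|k IH] w /=; first by move=> x _; exact: cvg_cst.
split=> [x _|v]; first exact: differentiable_cst.
by have -> : 'D_v (cst w) = cst 0 by apply/funext => x; rewrite derive_cst.
Qed.

End DifferentiableOrder.

Section DifferentiableOrderAlgebra.
Variables (R : realType) (V W : normedModType R).
Implicit Types (U : set V) (f g : V -> W).

Lemma differentiable_orderD k U f g : open U ->
  differentiable_order k U f -> differentiable_order k U g ->
  differentiable_order k U (f + g).
Proof.
move=> oU; elim: k f g => [|k IH] f g.
  by move=> cf cg x Ux; apply: cvgD; [exact: cf|exact: cg].
move=> [df dDf] [dg dDg]; split=> [x Ux|v].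
  by apply: differentiableD; [exact: df|exact: dg].
apply: (differentiable_order_eq oU) (IH _ _ (dDf v) (dDg v)) => x Ux.
rewrite deriveD //; first exact/diff_derivable/df.
exact/diff_derivable/dg.
Qed.

(** Leibniz rule: in each of the two summands one factor is differentiated and the other is weakened
    to order [k], so the induction hypothesis applies. With [W := R] this covers products of scalar
    functions. *)
Lemma differentiable_orderZ k U (s : V -> R) f : open U ->
  differentiable_order k U s -> differentiable_order k U f ->
  differentiable_order k U (fun x => s x *: f x).
Proof.
move=> oU; elim: k s f => [|k IH] s f.
  by move=> cs cf x Ux; apply: cvgZ; [exact: cs|exact: cf].
move=> ks kf; have [ds dDs] := ks; have [df dDf] := kf.
split=> [x Ux|v].
  by case: (is_diff_scale (ds _ Ux) (df _ Ux)).
have ks' := differentiable_orderW ks; have kf' := differentiable_orderW kf.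
apply: (differentiable_order_eq oU)
  (differentiable_orderD oU (IH _ _ ks' (dDf v)) (IH _ _ (dDs v) kf')) => x Ux.
have [dsf dsfE] := is_diff_scale (ds _ Ux) (df _ Ux).
rewrite (deriveE _ dsf) dsfE !fctE.
rewrite !deriveE //; [exact: ds|exact: df].
Qed.

Lemma differentiable_order_sum k U I (r : seq I) (F : I -> V -> W) : open U ->
  (forall i, differentiable_order k U (F i)) ->
  differentiable_order k U (fun x => \sum_(i <- r) F i x).
Proof.
move=> oU kF; elim: r => [|i r IH].
  apply: (differentiable_order_eq oU) (differentiable_order_cst k U 0) => x _.
  by rewrite big_nil.
apply: (differentiable_order_eq oU) (differentiable_orderD oU (kF i) IH) => x _.
by rewrite big_cons.
Qed.

End DifferentiableOrderAlgebra.

Section DifferentiableOrderComp.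
Variables (R : realType).

Lemma differentiable_order_linear (V W Z : normedModType R) k (U : set V)
    (L : {linear W -> Z}) (f : V -> W) : open U -> continuous L ->
  differentiable_order k U f -> differentiable_order k U (L \o f).
Proof.
move=> oU cL; elim: k f => [|k IH] f.
  by move=> cf x Ux; apply: continuous_comp; [exact: cf|exact: cL].
move=> [df dDf]; have dL y : differentiable L y by exact: linear_differentiable.
split=> [x Ux|v]; first exact: differentiable_comp (df _ Ux) (dL _).
apply: (differentiable_order_eq oU) (IH _ (dDf v)) => x Ux /=.
have dLf : differentiable (L \o f) x by apply: differentiable_comp => //; exact: df.
by rewrite (deriveE _ dLf) (deriveE _ (df _ Ux)) (diff_comp (df _ Ux) (dL _)) diff_lin.
Qed.

Lemma differentiable_order_prod k (V : normedModType R) (U : set V) I (r : seq I)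
    (F : I -> V -> R) : open U ->
  (forall i, differentiable_order k U (F i)) ->
  differentiable_order k U (fun x => \prod_(i <- r) F i x).
Proof.
move=> oU kF; elim: r => [|i r IH].
  have k1 : differentiable_order k U (cst (1 : R)).
    exact: differentiable_order_cst.
  by apply: (differentiable_order_eq oU) k1 => x _; rewrite big_nil.
apply: (differentiable_order_eq oU) (differentiable_orderZ oU (kF i) IH) => x _.
by rewrite big_cons.
Qed.

(** The derivative of [s^-1] is that of [s] scaled by [s^-1] twice and by [-1]; the factors [s^-1]
    are of order [k] by induction. *)
Lemma differentiable_orderV k (V : normedModType R) (U : set V) (s : V -> R) :
  open U -> (forall x, U x -> s x != 0) -> differentiable_order k U s ->
  differentiable_order k U (fun x => (s x)^-1).
Proof.
move=> oU s0; elim: k => [|k IH].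
  by move=> cs x Ux; apply: cvgV; [exact: s0|exact: cs].
move=> ks; have [ds dDs] := ks.
split=> [x Ux|v]; first by apply: differentiableV => //; [exact: ds|exact: s0].
have kV := IH (differentiable_orderW ks).
have kN : differentiable_order k U (cst (-1 : R)) by exact: differentiable_order_cst.
apply: (differentiable_order_eq oU) (differentiable_orderZ oU kN
  (differentiable_orderZ oU kV (differentiable_orderZ oU kV (dDs v)))) => x Ux.
rewrite deriveV ?s0 //; last exact/diff_derivable/ds.
by rewrite /cst scaleN1r scaleNr expr2 invfM scalerA.
Qed.

Lemma differentiable_order_entry k (V : normedModType R) (U : set V) m n
    (f : V -> 'M[R]_(m, n)) i j : open U ->
  differentiable_order k U f -> differentiable_order k U (fun x => f x i j).
Proof.
move=> oU.
have lin : linear (fun A : 'M[R]_(m, n) => A i j).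
  by move=> b A B; rewrite !mxE.
pose L : {linear 'M[R]_(m, n) -> R} :=
  HB.pack (fun A : 'M[R]_(m, n) => A i j) (GRing.isLinear.Build _ _ _ _ _ lin).
exact: (@differentiable_order_linear _ _ _ _ _ L _ oU (@coord_continuous _ _ _ i j)).
Qed.

Lemma differentiable_order_mx k (V : normedModType R) (U : set V) m n
    (f : V -> 'M[R]_(m, n)) : open U ->
  (forall i j, differentiable_order k U (fun x => f x i j)) ->
  differentiable_order k U f.
Proof.
move=> oU kf.
have kc i j : differentiable_order k U (cst (delta_mx i j : 'M[R]_(m, n))).
  exact: differentiable_order_cst.
apply: (differentiable_order_eq oU) (differentiable_order_sum (index_enum _) oU
  (fun i => differentiable_order_sum (index_enum _) oU
    (fun j => differentiable_orderZ oU (kf i j) (kc i j)))) => x Ux.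
by rewrite [RHS]matrix_sum_delta.
Qed.

(** The chain rule differentiates [g] in the direction ['D_v f x], which varies with [x], whereas
    [differentiable_order] controls fixed directions only. Expanding along the basis moves the
    variation into scalar coefficients. *)
Lemma derive_comp_rV p (V W : normedModType R) (f : V -> 'rV[R]_p)
    (g : 'rV[R]_p -> W) x v : differentiable f x -> differentiable g (f x) ->
  'D_v (g \o f) x = \sum_j 'D_v f x 0 j *: 'D_(delta_mx 0 j) g (f x).
Proof.
move=> df dg; rewrite deriveE; last exact: differentiable_comp.
rewrite diff_comp //= -(deriveE v df).
rewrite {1}['D_v f x]row_sum_delta linear_sum; apply: eq_bigr => j _.
by rewrite linearZ (deriveE _ dg).
Qed.

Lemma differentiable_order_comp k p (V W : normedModType R) (U : set V)
    (U' : set 'rV[R]_p) (f : V -> 'rV[R]_p) (g : 'rV[R]_p -> W) : open U ->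
  (forall x, U x -> U' (f x)) ->
  differentiable_order k U f -> differentiable_order k U' g ->
  differentiable_order k U (g \o f).
Proof.
move=> oU UU'; elim: k f g UU' => [|k IH] f g UU'.
  by move=> cf cg x Ux; apply: continuous_comp; [exact: cf|exact/cg/UU'].
move=> kf [dg dDg]; have kf' := differentiable_orderW kf; have [df dDf] := kf.
split=> [x Ux|v]; first by apply: differentiable_comp; [exact: df|exact/dg/UU'].
apply: (differentiable_order_eq oU) (differentiable_order_sum (index_enum _) oU
  (fun j => differentiable_orderZ oU
    (differentiable_order_entry 0 j oU (dDf v))
    (IH _ _ UU' kf' (dDg (delta_mx 0 j))))) => x Ux.
by rewrite derive_comp_rV //; [exact: df|exact/dg/UU'].
Qed.

End DifferentiableOrderComp.

Section DifferentiableOrderMatrix.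
Variables (R : realType) (V : normedModType R) (k : nat) (U : set V).
Hypothesis oU : open U.

Lemma differentiable_order_mulmx m n p (f : V -> 'M[R]_(m, n))
    (g : V -> 'M[R]_(n, p)) :
  differentiable_order k U f -> differentiable_order k U g ->
  differentiable_order k U (fun x => f x *m g x).
Proof.
move=> kf kg; apply: differentiable_order_mx => // i j.
apply: (differentiable_order_eq oU) (differentiable_order_sum (index_enum _) oU
  (fun l => differentiable_orderZ oU (differentiable_order_entry i l oU kf)
    (differentiable_order_entry l j oU kg))) => x Ux.
by rewrite mxE.
Qed.

Lemma differentiable_order_det n (f : V -> 'M[R]_n) :
  differentiable_order k U f -> differentiable_order k U (fun x => \det (f x)).
Proof.
move=> kf; have kc b : differentiable_order k U (cst ((-1) ^+ b : R)).
  exact: differentiable_order_cst.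
apply: (differentiable_order_eq oU) (differentiable_order_sum (index_enum _) oU
  (fun s : 'S_n => differentiable_orderZ oU (kc s)
    (differentiable_order_prod (index_enum _) oU
      (fun i => differentiable_order_entry i (s i) oU kf)))) => x Ux.
by [].
Qed.

(** Cramer's rule: the inverse is the adjugate divided by the determinant, both polynomial in the
    entries. *)
Lemma differentiable_order_invmx n (f : V -> 'M[R]_n) :
  (forall x, U x -> f x \in unitmx) -> differentiable_order k U f ->
  differentiable_order k U (fun x => invmx (f x)).
Proof.
move=> fU kf; have kV : differentiable_order k U (fun x => (\det (f x))^-1).
  apply: differentiable_orderV => //; last exact: differentiable_order_det.
  by move=> x /fU; rewrite unitmxE unitfE.
have kA : differentiable_order k U (fun x => \adj (f x)).
  apply: differentiable_order_mx => // i j.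
  have kc : differentiable_order k U (cst ((-1) ^+ (j + i) : R)).
    exact: differentiable_order_cst.
  have km : differentiable_order k U (fun x => row' j (col' i (f x))).
    apply: differentiable_order_mx => // l l'.
    apply: (differentiable_order_eq oU)
      (differentiable_order_entry (lift j l) (lift i l') oU kf) => x Ux.
    by rewrite !mxE.
  apply: (differentiable_order_eq oU)
    (differentiable_orderZ oU kc (differentiable_order_det km)) => x Ux.
  by rewrite mxE.
apply: (differentiable_order_eq oU) (differentiable_orderZ oU kV kA) => x Ux.
by rewrite /invmx fU.
Qed.

End DifferentiableOrderMatrix.

(** * The inverse function theorem *)

Section SupNorm.
Variable R : realType.

Lemma mx_norm_le m n (A : 'M[R]_(m, n)) (b : R) : 0 <= b ->
  (`|A| <= b) <-> (forall i j, `|A i j| <= b).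
Proof.
move=> b0; rewrite {1}/Num.Def.normr /= mx_normrE; split=> [/bigmax_leP[_ H] i j|H].
  exact: (H (i, j)).
by apply/bigmax_leP; split=> // -[i j] _; exact: H.
Qed.

Lemma mx_norm_entry m n (A : 'M[R]_(m, n)) i j : `|A i j| <= `|A|.
Proof. exact: (mx_norm_le A (normr_ge0 A)).1. Qed.

(** The scalar mean value theorem is applied to each entry along the segment from [u'] to [u]; as
    the norm is the largest absolute value of an entry, no constant is lost. *)
Lemma mean_value_ball n p (g : 'rV[R]_n -> 'rV[R]_p) u0 (e c : R) : 0 <= c ->
  (forall u, ball u0 e u -> differentiable g u) ->
  (forall u v, ball u0 e u -> `|'d g u v| <= c * `|v|) ->
  forall u u', ball u0 e u -> ball u0 e u' -> `|g u - g u'| <= c * `|u - u'|.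
Proof.
move=> c0 dg bg u u' uB u'B; apply/mx_norm_le; first exact: mulr_ge0.
move=> i j.
pose l (t : R) := u' + t *: (u - u').
have lB (t : R) : t \in `[0, 1]%R -> ball u0 e (l t).
  rewrite in_itv /= => /andP[t0 t1].
  have -> : l t = t *: u + (1 - t) *: u'.
    by rewrite /l scalerBr scalerBl scale1r addrCA.
  move: uB u'B; rewrite -!ball_normE /ball_ /= => uB u'B.
  have -> : u0 - (t *: u + (1 - t) *: u') = t *: (u0 - u) + (1 - t) *: (u0 - u').
    by rewrite !scalerBr addrACA -scalerDl (addrC t) subrK scale1r opprD.
  (* For [t > 0] the strict inequality comes from the summand scaled by [t], so [t = 0] is treated
     apart. *)
  have [->|tn0] := eqVneq t 0; first by rewrite scale0r add0r subr0 scale1r.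
  have t0' : 0 < t by rewrite lt_neqAle eq_sym tn0.
  apply: le_lt_trans (ler_normD _ _) _.
  rewrite !normrZ (ger0_norm t0) ger0_norm ?subr_ge0 //.
  have -> : e = t * e + (1 - t) * e by rewrite -mulrDl (addrC t) subrK mul1r.
  by apply: ltr_leD; [rewrite ltr_pM2l|apply: ler_wpM2l; rewrite ?subr_ge0// ltW].
pose h (t : R) : R := g (l t) i j.
have dl (t : R) : is_diff t l (fun s => s *: (u - u')).
  by apply: is_diff_eq; rewrite add0r.
have dh (t : R) : t \in `[0, 1]%R ->
    is_diff t h (fun s => 'd g (l t) (s *: (u - u')) i j).
  move=> /lB ltB.
  have lin : linear (fun A : 'M[R]_(1, p) => A i j) by move=> b A B; rewrite !mxE.
  pose L : {linear 'M[R]_(1, p) -> R} :=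
    HB.pack (fun A : 'M[R]_(1, p) => A i j) (GRing.isLinear.Build _ _ _ _ _ lin).
  have cL : continuous L by exact: (@coord_continuous R 1 p i j).
  have [dlt dltE] := dl t.
  have dgl := differentiable_comp dlt (dg _ ltB).
  have dLt y : differentiable L y by exact: linear_differentiable.
  have -> : h = L \o (g \o l) by [].
  apply: DiffDef; first exact: differentiable_comp.
  rewrite (diff_comp dgl (dLt _)) (diff_comp dlt (dg _ ltB)) (diff_lin _ cL).
  by apply/funext => s /=; rewrite dltE.
have dh1 (t : R) : t \in `[0, 1]%R -> is_derive t 1 h ('d g (l t) (u - u') i j).
  move=> /dh[dht dhE]; apply: DeriveDef; first exact: diff_derivable.
  by rewrite deriveE // dhE scale1r.
have ch : {within `[0, 1], continuous h}.
  apply: continuous_in_subspaceT => t /set_mem /dh[dht _].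
  exact: differentiable_continuous.
have dh2 (t : R) : t \in `]0, 1[%R -> is_derive t 1 h ('d g (l t) (u - u') i j).
  by move=> t01; apply: dh1; apply: subset_itv_oo_cc t01.
have [t t01 hE] := MVT_segment ler01 dh2 ch.
move: hE; rewrite /h /l scale0r addr0 scale1r (addrC u') subrK subr0 mulr1 => gE.
rewrite !mxE gE.
exact: le_trans (mx_norm_entry _ i j) (bg _ _ (lB _ t01)).
Qed.

Lemma rV_norm_sum_delta n p (L : {linear 'rV[R]_n -> 'rV[R]_p}) (b : R) :
  0 <= b -> (forall j, `|L (delta_mx 0 j)| <= b) ->
  forall v, `|L v| <= n%:R * b * `|v|.
Proof.
move=> b0 Lb v; rewrite {1}[v]row_sum_delta linear_sum.
apply: le_trans (ler_norm_sum _ _ _) _.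
have -> : n%:R * b * `|v| = \sum_(j < n) `|v| * b.
  by rewrite sumr_const card_ord -mulrA mulr_natl (mulrC b).
apply: ler_sum => j _; rewrite linearZ normrZ.
by apply: ler_pM => //; exact: mx_norm_entry.
Qed.

End SupNorm.

Section Jacobian.
Variable R : realType.

(** Order 0 is continuity, so the closure lemmas apply to the expansion of [L] along the basis. *)
Lemma linear_rV_continuous n (W : normedModType R) (L : {linear 'rV[R]_n -> W}) :
  continuous L.
Proof.
have oT := @openT 'rV[R]_n.
have k1 : differentiable_order 0 [set: 'rV[R]_n] id by move=> x _; exact: cvg_id.
suff : differentiable_order 0 [set: 'rV[R]_n] L by move=> H x; exact: H.
apply: (differentiable_order_eq oT) (differentiable_order_sum (index_enum _) oT
  (fun j => differentiable_orderZ oT (differentiable_order_entry 0 j oT k1)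
     (differentiable_order_cst _ _ (L (delta_mx 0 j))))) => x _.
by rewrite [x in RHS]row_sum_delta linear_sum; apply: eq_bigr => j _; rewrite linearZ.
Qed.

Lemma differentiable_order_jacobian n p k (U : set 'rV[R]_n)
    (F : 'rV[R]_n -> 'rV[R]_p) : open U ->
  differentiable_order k.+1 U F -> differentiable_order k U (jacobian F).
Proof.
move=> oU [dF dDF]; apply: differentiable_order_mx => // i j.
apply: (differentiable_order_eq oU)
  (differentiable_order_entry 0 j oU (dDF (delta_mx 0 i))) => u Uu.
by rewrite deriveE ?mxE //; exact: dF.
Qed.

Lemma smooth_on_differentiable (V W : normedModType R) (U : set V) (F : V -> W) u :
  smooth_on U F -> U u -> differentiable F u.
Proof. by move=> /(_ 1)[dF _]; exact: dF. Qed.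

End Jacobian.

Section InverseFunction.
Variables (R : realType) (n : nat).
Implicit Types (F : 'rV[R]_n -> 'rV[R]_n).

(** The partial derivatives are finitely many and continuous at [u0], so near [u0] all of them are
    close to the basis vectors at once. *)
Lemma near_id_diff F (U : set 'rV[R]_n) u0 : open U -> U u0 -> smooth_on U F ->
  (forall v, 'd F u0 v = v) ->
  exists2 e : R, 0 < e & forall u, ball u0 e u ->
    U u /\ forall v, `|v - 'd F u v| <= 2^-1 * `|v|.
Proof.
move=> oU Uu0 sF dF0.
(* Summing over the basis costs a factor [n], and [n * c <= 1/2]; [n.+1] keeps [c] positive when
   [n = 0]. *)
pose c : R := (2 * n.+1%:R)^-1.
have c0 : 0 < c by rewrite invr_gt0 mulr_gt0.
have nD : \forall u \near u0, forall j : 'I_n,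
    `|delta_mx 0 j - 'D_(delta_mx 0 j) F u| < c.
  apply: (@filter_forall _ _ (fun (j : 'I_n) u =>
    `|delta_mx 0 j - 'D_(delta_mx 0 j) F u| < c) (nbhs u0) _) => j.
  have cD : {for u0, continuous ('D_(delta_mx 0 j) F)}.
    by have [_ dDF] := sF 1; exact: (dDF (delta_mx 0 j) u0 Uu0).
  have d0 : 'D_(delta_mx 0 j) F u0 = delta_mx 0 j.
    by rewrite deriveE ?dF0 //; exact: smooth_on_differentiable sF Uu0.
  move/cvgrPdist_lt : cD => /(_ c c0); rewrite d0.
  by [].
have nU : nbhs u0 U by exact: open_nbhs_nbhs.
have /nbhs_ballP[e e0 He] : nbhs u0 [set u | U u /\
    forall j : 'I_n, `|delta_mx 0 j - 'D_(delta_mx 0 j) F u| < c].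
  by apply: filterS2 nU nD.
exists e => // u /He[Uu Hu]; split => // v.
have dFu : differentiable F u by exact: smooth_on_differentiable sF Uu.
have lin : linear (fun w => w - 'd F u w).
  by move=> b w w'; rewrite linearP scalerBr opprD addrACA.
pose L : {linear 'rV[R]_n -> 'rV[R]_n} :=
  HB.pack (fun w => w - 'd F u w) (GRing.isLinear.Build _ _ _ _ _ lin).
apply: le_trans (@rV_norm_sum_delta _ _ _ L c (ltW c0) _ v) _.
  by move=> j; rewrite /= -deriveE // ltW.
apply: ler_wpM2r => //; rewrite /c invfM mulrA ler_pdivrMr // mulrC.
by rewrite ler_pM2l ?invr_gt0 // ler_nat.
Qed.

(** On a small ball [id - F] contracts by [1/2], so [F] shrinks distances at most by half and its
    inverse is 2-Lipschitz. Asking for the differential [id] costs nothing: each application first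
    composes with a suitable matrix. *)
Lemma inverse_function F (U : set 'rV[R]_n) u0 : open U -> U u0 -> smooth_on U F ->
  (forall v, 'd F u0 v = v) ->
  exists (H : 'rV[R]_n -> 'rV[R]_n) (e r : R), [/\ 0 < e /\ 0 < r,
    forall u, ball u0 e u -> U u /\ jacobian F u \in unitmx,
    forall y, ball (F u0) r y -> ball u0 e (H y) /\ F (H y) = y,
    forall u, ball u0 e u -> H (F u) = u &
    smooth_on (ball (F u0) r) H].
Proof.
move=> oU Uu0 sF dF0; have [e e0 He] := near_id_diff oU Uu0 sF dF0.
have dF u : ball u0 e u -> differentiable F u.
  by move=> /He[+ _]; exact: smooth_on_differentiable.
pose G := id - F.
have dG u : ball u0 e u -> is_diff u G (fun v => v - 'd F u v).
  by move=> /dF/differentiableP df; apply: is_diff_eq.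
have dG' u : ball u0 e u -> differentiable G u by move=> /dG[].
have bG u v : ball u0 e u -> `|'d G u v| <= 2^-1 * `|v|.
  by move=> Bu; have [_ ->] := dG _ Bu; exact: (He _ Bu).2.
have half0 : 0 <= 2^-1 :> R by rewrite invr_ge0.
have GL := mean_value_ball half0 dG' bG.
have FL u u' : ball u0 e u -> ball u0 e u' ->
    `|u - u'| <= 2 * `|F u - F u'|.
  move=> Bu Bu'; have := GL _ _ Bu Bu'.
  have : `|u - u'| <= `|F u - F u'| + `|G u - G u'|.
    have -> : u - u' = (F u - F u') + (G u - G u').
      by rewrite /G !fctE; apply/rowP => j; rewrite !mxE; ring.
    exact: ler_normD.
  lra.
have Finj u u' : ball u0 e u -> ball u0 e u' -> F u = F u' -> u = u'.
  move=> Bu Bu' FF; apply/subr0_eq/eqP; rewrite -normr_le0.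
  by have := FL _ _ Bu Bu'; rewrite FF subrr normr0 mulr0.
have Bu0 : ball u0 e u0 by exact: ballxx.
(* The minimizer [u] found below is within [4 * r] of [u0] and the correction [r'] is shorter than
   [r]; [5 * r = e / 2] keeps [u + r'] in the compact ball. *)
pose r := e / 10; have r0 : 0 < r by rewrite divr_gt0.
have Fsurj y : ball (F u0) r y -> exists2 u, ball u0 e u & F u = y.
  move=> Fy; have {}Fy : `|y - F u0| < r.
    by move: Fy; rewrite -ball_normE /ball_ /= distrC.
  pose K := closed_ball u0 (e / 2).
  have e20 : 0 < e / 2 by rewrite divr_gt0.
  have e2e : e / 2 < e by lra.
  have KB : K `<=` ball u0 e by exact: closed_ball_subset.
  have Ku0 : K u0 by exact: closed_ballxx.
  have cK : compact K.
    apply: bounded_closed_compact; last exact: closed_ball_closed.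
    exists (`|u0| + e / 2); split; first exact: num_real.
    move=> M lM u; rewrite /K closed_ballE // /closed_ball_ /= => Ku.
    apply: le_trans (ltW lM); rewrite -[u](subKr u0).
    by apply: le_trans (ler_normB _ _) _; rewrite lerD2l.
  have cf : {within K, continuous (fun u => `|F u - y|)}.
    apply: continuous_in_subspaceT => u /set_mem /KB /dF dFu.
    apply: (@continuous_comp _ _ _ (fun u => F u - y) Num.Def.normr);
      last exact: norm_continuous.
    by apply: continuousB; [exact: differentiable_continuous|exact: cst_continuous].
  (* A closest point [F u] to [y] is [y] itself, since otherwise
     [u + (y - F u)] would do better. *)
  have [u uK umin] := @EVT_min_rV R n _ K (ex_intro _ u0 Ku0) cK cf.
  have Ku : K u by exact: set_mem.
  exists u; first exact: KB.
  apply/eqP/negPn/negP => /eqP Fu; set r' := y - F u.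
  have r'0 : 0 < `|r'| by rewrite normr_gt0 subr_eq0; apply/eqP => /esym.
  have := umin u0 (mem_set Ku0); rewrite (distrC (F u)) (distrC (F u0)) -/r' => r'le.
  have uu0 := FL _ _ (KB _ Ku) Bu0.
  have FFl : `|F u - F u0| <= `|r'| + `|y - F u0|.
    rewrite (distrC (F u)) -[F u0 - F u](subrKA y) addrC (distrC y (F u0)).
    exact: ler_normD.
  have ur'u0 : `|u + r' - u0| <= `|u - u0| + `|r'|.
    by rewrite addrAC; exact: ler_normD.
  have ur'K : K (u + r').
    rewrite /K closed_ballE // /closed_ball_ /= distrC.
    by rewrite /r in Fy; lra.
  have := umin _ (mem_set ur'K); rewrite (distrC (F u)) -/r'.
  (* Since [F = id - G], the new error is a difference of values of [G], hence at most half of the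
     old one. *)
  have -> : F (u + r') - y = G u - G (u + r').
    by rewrite /G /r' !fctE; apply/rowP => j; rewrite !mxE; ring.
  have := GL _ _ (KB _ Ku) (KB _ ur'K).
  have -> : u - (u + r') = - r' by rewrite [u + r']addrC opprD addrC subrK.
  rewrite normrN; lra.
have JU u : ball u0 e u -> jacobian F u \in unitmx.
  move=> Bu; rewrite -row_free_unit; apply: inj_row_free => v.
  rewrite /jacobian mul_rV_lin1 => dv0; apply/eqP; rewrite -normr_le0.
  by have := (He _ Bu).2 v; rewrite dv0 subr0; have := normr_ge0 v; lra.
(* A choice of preimage in the ball; [u0] is a default for values [y] that are not attained
   there. *)
pose H y := xget u0 [set u | ball u0 e u /\ F u = y].
have HP y : ball (F u0) r y -> ball u0 e (H y) /\ F (H y) = y.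
  move=> /Fsurj[u Bu Fu].
  exact: (@xgetPex _ u0 [set u | ball u0 e u /\ F u = y] (ex_intro _ u (conj Bu Fu))).
have HF u : ball u0 e u -> H (F u) = u.
  move=> Bu.
  have [Bv Fv] := @xgetPex _ u0 [set v | ball u0 e v /\ F v = F u]
    (ex_intro _ u (conj Bu (erefl _))).
  exact: Finj.
have HL y y' : ball (F u0) r y -> ball (F u0) r y' -> `|H y - H y'| <= 2 * `|y - y'|.
  by move=> /HP[By Fy] /HP[By' Fy']; have := FL _ _ By By'; rewrite Fy Fy'.
have oB : open (ball (F u0) r) by exact: ball_open.
have cH y : ball (F u0) r y -> {for y, continuous H}.
  move=> By; apply/(@cvgrPdist_lt R 'rV[R]_n _ (nbhs y) _) => d d0.
  have nB : nbhs y (ball (F u0) r) by exact: open_nbhs_nbhs.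
  have nD : nbhs y (ball y (d / 2)) by apply: nbhsx_ballx; exact: divr_gt0.
  apply: filterS2 nB nD => y' By'; rewrite -(ball_normE (V:='rV[R]_n)) => Dy'.
  by apply: le_lt_trans (HL _ _ By By') _; rewrite mulrC -ltr_pdivlMr.
have dH y : ball (F u0) r y ->
    is_diff y H (fun v => v *m invmx (jacobian F (H y))).
  move=> By; have [Bu Fu] := HP _ By; set u := H y in Bu Fu *.
  pose L : {linear 'rV[R]_n -> 'rV[R]_n} := mulmxr (invmx (jacobian F u)).
  have cL : continuous L by exact: linear_rV_continuous.
  have [C C0 LC] := linear_lipschitz cL.
  apply: (@is_diff_near _ _ _ H y L cL) => d d0.
  (* [C] bounds the linear map [L], and [2] is the Lipschitz constant of [H]. *)
  have d'0 : 0 < d / (2 * C) by rewrite divr_gt0 // mulr_gt0.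
  have nF := differentiable_near (dF _ Bu) d'0.
  have nB : nbhs y (ball (F u0) r) by exact: open_nbhs_nbhs.
  have nFH : nbhs y [set y' | `|F (H y') - F u - 'd F u (H y' - u)| <=
      d / (2 * C) * `|H y' - u|] by exact: (cH _ By _ nF).
  apply: filterS2 nB nFH => y' By' /=; have [Bu' Fu'] := HP _ By'.
  rewrite Fu' Fu => hF.
  (* The remainder of [H] at [y] is the image under [- L] of the remainder of [F] at [u]. *)
  have -> : H y' - H y - L (y' - y) = - L (y' - y - 'd F u (H y' - u)).
    have LE w : L ('d F u w) = w.
      by rewrite /= -mul_rV_lin1 -/(jacobian F u) -mulmxA mulmxV ?mulmx1 // JU.
    have LB w w' : L (w - w') = L w - L w' by exact: linearB.
    by rewrite (LB (y' - y)) LE opprB.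
  rewrite normrN; apply: le_trans (LC _) _.
  have -> : d * `|y' - y| = C * (d / (2 * C) * (2 * `|y' - y|)).
    by field; rewrite gt_eqF.
  rewrite ler_pM2l //; apply: le_trans hF _; rewrite ler_pM2l //.
  exact: HL.
exists H, e, r; split => //; first by move=> u Bu; split; [exact: (He _ Bu).1|exact: JU].
have smJ k : differentiable_order k (ball u0 e) (jacobian F).
  apply: (@differentiable_order_sub _ _ _ _ U); first by move=> u /He[].
  exact: differentiable_order_jacobian.
have ouB : open (ball u0 e) by exact: ball_open.
(* Bootstrap: the formula for the differential of [H] involves [H] itself without derivatives, so
   order [k] of [H] yields order [k.+1]. *)
elim=> [|k IH]; first exact: cH.
split=> [y By|v]; first by have [] := dH _ By.
have kI : differentiable_order k (ball (F u0) r) (fun y => invmx (jacobian F (H y))).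
  apply: differentiable_order_invmx => //; first by move=> y /HP[/JU].
  by apply: (differentiable_order_comp oB _ IH (smJ k)) => y /HP[].
apply: (differentiable_order_eq oB) (differentiable_order_mulmx oB
  (differentiable_order_cst _ _ v) kI) => y By.
have [dHy dHE] := dH _ By.
by rewrite (deriveE v dHy) dHE.
Qed.

End InverseFunction.

(** * Smooth maps and Jacobian matrices *)

Section SmoothOn.
Variable R : realType.
Implicit Types V W : normedModType R.

Lemma smooth_on_sub V W (U U' : set V) (f : V -> W) : U' `<=` U ->
  smooth_on U f -> smooth_on U' f.
Proof. by move=> UU' sf k; exact: differentiable_order_sub (sf k). Qed.

Lemma smooth_on_eq V W (U : set V) (f g : V -> W) : open U ->
  (forall x, U x -> f x = g x) -> smooth_on U f -> smooth_on U g.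
Proof. by move=> oU fg sf k; exact: differentiable_order_eq (sf k). Qed.

Lemma smooth_on_local V W (U : set V) (f : V -> W) :
  (forall x, U x -> exists2 Y, Y x & smooth_on Y f) -> smooth_on U f.
Proof.
move=> H k; apply: differentiable_order_local => x /H[Y Yx sY].
by exists Y => //; exact: sY.
Qed.

Lemma smooth_on_id V (U : set V) : smooth_on U (@id V).
Proof.
case=> [|k] /=; first by move=> x _; exact: cvg_id.
split=> [x _|v]; first by case: (is_diff_id x).
have -> : 'D_v id = cst v by apply/funext => x; rewrite derive_id.
exact: differentiable_order_cst.
Qed.

Lemma smooth_on_cst V W (U : set V) (w : W) : smooth_on U (cst w).
Proof. by move=> k; exact: differentiable_order_cst. Qed.

Lemma smooth_onD V W (U : set V) (f g : V -> W) : open U ->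
  smooth_on U f -> smooth_on U g -> smooth_on U (fun x => f x + g x).
Proof. by move=> oU sf sg k; exact: differentiable_orderD (sf k) (sg k). Qed.

Lemma smooth_on_mulmx V (U : set V) m n p (f : V -> 'M[R]_(m, n)) (Q : 'M[R]_(n, p)) :
  open U -> smooth_on U f -> smooth_on U (fun x => f x *m Q).
Proof.
move=> oU sf k.
exact: (differentiable_order_mulmx oU (sf k) (differentiable_order_cst k U Q)).
Qed.

Lemma smooth_on_comp V W p (U : set V) (U' : set 'rV[R]_p) (f : V -> 'rV[R]_p)
    (g : 'rV[R]_p -> W) : open U -> (forall x, U x -> U' (f x)) ->
  smooth_on U f -> smooth_on U' g -> smooth_on U (g \o f).
Proof. by move=> oU ? sf sg k; exact: differentiable_order_comp (sf k) (sg k). Qed.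

Lemma smooth_on_continuous V W (U : set V) (f : V -> W) x :
  smooth_on U f -> U x -> {for x, continuous f}.
Proof. by move=> /(_ 0); exact. Qed.

Lemma diffEjacobian n p (f : 'rV[R]_n -> 'rV[R]_p) u v :
  'd f u v = v *m jacobian f u.
Proof. by rewrite /jacobian mul_rV_lin1. Qed.

(** Chart representatives simplify only near a point; their Jacobians are computed by replacing them
    with a map of known differential and the same germ. *)
Lemma jacobian_near n p (f g : 'rV[R]_n -> 'rV[R]_p) u (L : 'M[R]_(n, p)) :
  is_diff u f (mulmx^~ L) -> {near u, f =1 g} ->
  differentiable g u /\ jacobian g u = L.
Proof.
move=> [df dfE] fg; have [dg dgE] := near_eq_is_diff fg df.
split; first exact: dg.
apply/row_matrixP => i.
by rewrite !rowE -diffEjacobian dgE dfE.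
Qed.

Lemma is_diff_jacobian n p (f : 'rV[R]_n -> 'rV[R]_p) u :
  differentiable f u -> is_diff u f (mulmx^~ (jacobian f u)).
Proof.
move=> df; apply: DiffDef => //; apply/funext => v.
by rewrite diffEjacobian.
Qed.

Lemma is_diff_mulmxr n p (Q : 'M[R]_(n, p)) (u : 'rV[R]_n) :
  is_diff u (mulmx^~ Q) (mulmx^~ Q).
Proof.
pose L : {linear 'rV[R]_n -> 'rV[R]_p} := mulmxr Q.
have cL : continuous L by exact: linear_rV_continuous.
by apply: DiffDef; [exact: (linear_differentiable _ cL)|exact: (diff_lin u cL)].
Qed.

Lemma is_diff_comp_jacobian n p q (f : 'rV[R]_n -> 'rV[R]_p) (g : 'rV[R]_p -> 'rV[R]_q) u :
  differentiable f u -> differentiable g (f u) ->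
  is_diff u (g \o f) (mulmx^~ (jacobian f u *m jacobian g (f u))).
Proof.
move=> df dg; apply: DiffDef; first exact: differentiable_comp.
rewrite diff_comp //; apply/funext => v /=.
by rewrite !diffEjacobian mulmxA.
Qed.

Lemma is_diff_id_jacobian n (u : 'rV[R]_n) : is_diff u id (mulmx^~ (1%:M : 'M[R]_n)).
Proof. by apply: is_diff_eq; apply/funext => v /=; rewrite mulmx1. Qed.

End SmoothOn.

(** * Injective maps of constant rank *)

Section ConstantRank.
Variables (R : realType) (n p : nat).

(** The kernel of [B] lies in that of [B *m Q], and the rank hypothesis forces equal dimensions. *)
Lemma ker_mulmx_rank m (B : 'M[R]_(n, p)) (Q : 'M[R]_(p, m)) (v : 'rV[R]_n) :
  (\rank B <= \rank (B *m Q))%N -> v *m B *m Q = 0 -> v *m B = 0.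
Proof.
move=> rB vBQ.
have sk : (kermx B <= kermx (B *m Q))%MS by rewrite sub_kermx mulmxA mulmx_ker mul0mx.
have sk' : (kermx (B *m Q) <= kermx B)%MS.
  by rewrite -(geq_leqif (mxrank_leqif_sup sk)) !mxrank_ker leq_sub2l.
by apply/sub_kermxP; apply: submx_trans sk'; apply/sub_kermxP; rewrite mulmxA.
Qed.

(* With [Q] a reflexive generalized inverse of the Jacobian [A] of [f] at [u0] and
   [E = A *m Q], the map [F u = f u *m Q + u *m (1 - E)] has differential [id] at
   [u0], and in the coordinates [F] the map [f] does not vary along the
   directions killed by [E]; injectivity of [f] forces [E = 1]. *)
Lemma constant_rank_injective (f : 'rV[R]_n -> 'rV[R]_p) (U : set 'rV[R]_n) u0 :
  open U -> U u0 -> smooth_on U f ->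
  (forall u, U u -> \rank (jacobian f u) = \rank (jacobian f u0)) ->
  (forall u v, U u -> U v -> f u = f v -> u = v) ->
  row_free (jacobian f u0).
Proof.
move=> oU Uu0 sf rk inj.
set A := jacobian f u0.
have [Q0 AQ0A] : exists Q0, A *m Q0 *m A = A.
  by exists (pinvmx A); exact: mulmxKpV.
(* Replacing [Q0] by [Q0 *m A *m Q0] adds the second identity, which gives [Q *m E = Q]. *)
have [Q [AQA QAQ]] : exists Q, A *m Q *m A = A /\ Q *m A *m Q = Q.
  exists (Q0 *m A *m Q0); split; first by rewrite !mulmxA AQ0A AQ0A.
  have cancel m (B : 'M[R]_(p, m)) : A *m (Q0 *m (A *m B)) = A *m B.
    by rewrite (mulmxA Q0) (mulmxA A) (mulmxA A) AQ0A.
  by rewrite -!mulmxA !cancel.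
pose E := A *m Q; have EE : E *m E = E by rewrite /E mulmxA AQA.
have QE : Q *m E = Q by rewrite /E mulmxA.
have rE : \rank E = \rank A.
  by apply/eqP; rewrite eqn_leq mxrankM_maxl -{1}AQA mxrankM_maxl.
have ECE : (1%:M - E) *m E = 0 by rewrite mulmxBl mul1mx EE subrr.
pose F u := f u *m Q + u *m (1%:M - E).
have sF : smooth_on U F.
  apply: smooth_onD => //; first exact: smooth_on_mulmx.
  by apply: smooth_on_mulmx => //; exact: smooth_on_id.
have dF u : U u -> is_diff u F (mulmx^~ (jacobian f u *m Q + (1%:M - E))).
  move=> Uu; have df := smooth_on_differentiable sf Uu.
  have dq := is_diff_mulmxr Q (f u); have [dQ dQE] := dq.
  have dfj := is_diff_jacobian df.
  have d1 := @is_diff_comp _ _ _ _ _ _ _ _ _ dfj dq.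
  have d2 := is_diff_mulmxr (1%:M - E) u.
  have d3 : is_diff u F _ := is_diffD d1 d2.
  apply: (is_diff_eq d3); apply/funext => v.
  by rewrite !fctE /= mulmxDr mulmxA.
have JF u : U u -> jacobian F u = jacobian f u *m Q + (1%:M - E).
  by move=> /dF dFu; have [|] := jacobian_near dFu (g := F); [near=> x|].
have dF0 v : 'd F u0 v = v.
  by rewrite diffEjacobian JF // addrC subrK mulmx1.
have [H [e [r [[e0 r0] HU HP HF sH]]]] := inverse_function oU Uu0 sF dF0.
(* Invertibility of [jacobian F u] gives [n <= \rank (jacobian f u *m Q) + \rank (1 - E)], while
   [\rank (1 - E) + \rank E <= n]. So multiplying by [Q] does not lower the rank of
   [jacobian f u]. *)
have kf u (v : 'rV[R]_n) : ball u0 e u ->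
    v *m jacobian f u *m Q = 0 -> v *m jacobian f u = 0.
  move=> Bu; have [Uu] := HU _ Bu; rewrite JF // -row_free_unit => /eqP rF.
  apply: ker_mulmx_rank; rewrite rk // -/A -rE.
  have r1 := mulmx0_rank_max ECE.
  have r2 := mxrank_add (jacobian f u *m Q) (1%:M - E); rewrite rF in r2.
  have := leq_trans r1 r2.
  by rewrite [X in (_ <= X)%N -> _]addnC leq_add2l.
pose y0 := F u0.
(* With [v = w *m jacobian H y], multiplying [v *m jacobian F (H y) = w] by [E] leaves
   [v *m jacobian f (H y) *m Q = 0], and [kf] removes [Q]. *)
have dfH y w : ball y0 r y -> w *m E = 0 -> 'd (f \o H) y w = 0.
  move=> By wE; have [Bu Fu] := HP _ By; have [Uu _] := HU _ Bu.
  have dH := smooth_on_differentiable sH By.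
  have df := smooth_on_differentiable sf Uu.
  have dFu := smooth_on_differentiable sF Uu.
  have JFH : jacobian H y *m jacobian F (H y) = 1%:M.
    have nid : {near y, F \o H =1 id}.
      have : nbhs y (ball y0 r) by apply: open_nbhs_nbhs; split; first exact: ball_open.
      by apply: filterS => z /HP[].
    have [_ <-] := jacobian_near (is_diff_comp_jacobian dH dFu) nid.
    by have [|] := jacobian_near (is_diff_id_jacobian y) (g := id); [near=> x|].
  rewrite diff_comp //= (diffEjacobian H) (diffEjacobian f).
  have [v vE] : exists v, v = w *m jacobian H y by exists (w *m jacobian H y).
  rewrite -vE; apply: kf => //.
  have : v *m jacobian F (H y) = w by rewrite vE -mulmxA JFH mulmx1.
  rewrite JF // mulmxDr => /(congr1 (mulmxr E)) /=.
  by rewrite mulmxDl wE -!mulmxA ECE mulmx0 addr0 QE.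
suff rfE : row_free E by move: rfE; rewrite /row_free rE.
apply: inj_row_free => z zE; apply/eqP/negPn/negP => z0.
(* [1 - E] projects onto the directions killed by [E], so [f \o H \o l] has zero differential and is
   constant. As [l (t *: z) = y0 + t *: z], injectivity of [f] will force [z = 0]. *)
pose l (y : 'rV[R]_n) : 'rV[R]_n := y0 + y *m (1%:M - E).
have [d d0 Hd] : exists2 d : R, 0 < d & forall y, ball 0 d y -> ball y0 r (l y).
  have c : {for 0, continuous l}.
    apply: (smooth_on_continuous (U:=setT)) => //.
    apply: smooth_onD; [exact: openT|exact: smooth_on_cst|].
    by apply: smooth_on_mulmx; [exact: openT|exact: smooth_on_id].
  have /c /nbhs_ballP[d d0 Hd] : nbhs (l 0) (ball y0 r).
    by rewrite /l mul0mx addr0; exact: nbhsx_ballx.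
  by exists d.
have dl y : is_diff y l (mulmx^~ (1%:M - E)).
  have dm := is_diff_mulmxr (1%:M - E) y.
  have dc := is_diff_cst y0 y.
  have d3 : is_diff y l _ := is_diffD dc dm.
  by apply: (is_diff_eq d3); apply/funext => v; rewrite !fctE add0r.
have dfHd y : ball y0 r y -> differentiable (f \o H) y.
  move=> By; have [Bu Fu] := HP _ By; have [Uu _] := HU _ Bu.
  apply: differentiable_comp; first exact: smooth_on_differentiable sH By.
  exact: smooth_on_differentiable sf Uu.
pose G := (f \o H) \o l.
have dG y : ball 0 d y -> differentiable G y.
  move=> /Hd By; apply: differentiable_comp; first by case: (dl y).
  exact: dfHd.
have bG y v : ball 0 d y -> `|'d G y v| <= 0 * `|v|.
  move=> /Hd By; have [dly dlE] := dl y.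
  rewrite (diff_comp dly (dfHd _ By)) /= dlE dfH ?normr0 ?mul0r //.
  by rewrite -mulmxA ECE mulmx0.
have zn : 0 < `|z| by rewrite normr_gt0.
pose t := d / (2 * `|z|); have t0 : 0 < t by rewrite divr_gt0 // mulr_gt0.
have Btz : ball 0 d (t *: z).
  rewrite -(ball_normE (V:='rV[R]_n)) /ball_ /= sub0r normrN normrZ gtr0_norm //.
  have -> : t * `|z| = d / 2 by rewrite /t; field; rewrite gt_eqF.
  lra.
have B0 : ball (0 : 'rV[R]_n) d 0 by exact: ballxx.
have := mean_value_ball (lexx 0) dG bG Btz B0.
rewrite mul0r normr_le0 subr_eq0 => /eqP.
rewrite /G /= => fHl; have [Bu Fu] := HP _ (Hd _ Btz); have [Bu' Fu'] := HP _ (Hd _ B0).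
have HH := inj _ _ (HU _ Bu).1 (HU _ Bu').1 fHl.
have : l (t *: z) = l 0 by rewrite -Fu -Fu' HH.
rewrite /l mul0mx addr0 mulmxBr mulmx1 -scalemxAl zE scaler0 subr0.
move=> /eqP; rewrite -subr_eq0 addrC addKr scaler_eq0 (negPf z0) gt_eqF //.
Unshelve. all: by end_near. Qed.

End ConstantRank.

(** * Smooth maps between manifolds *)

Section SmoothAt.
Variable R : realType.
Implicit Types V W : normedModType R.

(** Smoothness of a germ, with the neighborhood hidden so that composition needs no bookkeeping of
    domains. *)
Definition smooth_at V W (f : V -> W) (x : V) : Prop :=
  exists2 U : set V, open_nbhs x U & smooth_on U f.

Lemma open_setI_preimage (S T : topologicalType) (f : S -> T) (U : set S)
    (U' : set T) : open U -> (forall x, U x -> {for x, continuous f}) ->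
  open U' -> open (U `&` f @^-1` U').
Proof.
move=> oU cf oU'; rewrite openE => x [Ux U'fx].
have nU : nbhs x U by exact: open_nbhs_nbhs.
have nU' : nbhs x (f @^-1` U').
  by apply: (cf _ Ux); exact: open_nbhs_nbhs.
exact: filterI.
Qed.

Lemma smooth_on_at V W (U : set V) (f : V -> W) x :
  open U -> U x -> smooth_on U f -> smooth_at f x.
Proof. by move=> oU Ux sf; exists U. Qed.

Lemma smooth_atW V W (f : V -> W) x : smooth_at f x ->
  {for x, continuous f} /\ differentiable f x.
Proof.
move=> [U [oU Ux] sf]; split; first exact: (smooth_on_continuous sf Ux).
exact: smooth_on_differentiable sf Ux.
Qed.

Lemma smooth_at_near V W (f g : V -> W) x : {near x, f =1 g} ->
  smooth_at f x -> smooth_at g x.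
Proof.
rewrite /prop_near1 nbhsE => -[Y [oY Yx] fg] [U [oU Ux] sf].
exists (U `&` Y); first by split; [exact: openI|split].
apply: (@smooth_on_eq _ _ _ _ f); [exact: openI|by move=> y [_ /fg]|].
by apply: smooth_on_sub sf => y [].
Qed.

Lemma smooth_at_cst V W (w : W) (x : V) : smooth_at (cst w) x.
Proof. by exists setT; [split; [exact: openT|]|exact: smooth_on_cst]. Qed.

Lemma smooth_at_id V (x : V) : smooth_at id x.
Proof. by exists setT; [split; [exact: openT|]|exact: smooth_on_id]. Qed.

Lemma smooth_atD V W (f g : V -> W) x : smooth_at f x -> smooth_at g x ->
  smooth_at (fun y => f y + g y) x.
Proof.
move=> [U [oU Ux] sf] [U' [oU' U'x] sg].
exists (U `&` U'); first by split; [exact: openI|split].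
apply: smooth_onD; first exact: openI.
  by apply: smooth_on_sub sf => y [].
by apply: smooth_on_sub sg => y [].
Qed.

Lemma smooth_at_mulmx V m n p (f : V -> 'M[R]_(m, n)) (Q : 'M[R]_(n, p)) x :
  smooth_at f x -> smooth_at (fun y => f y *m Q) x.
Proof. by move=> [U [oU Ux] sf]; exists U => //; exact: smooth_on_mulmx. Qed.

Lemma smooth_at_comp V W p (f : V -> 'rV[R]_p) (g : 'rV[R]_p -> W) x :
  smooth_at f x -> smooth_at g (f x) -> smooth_at (g \o f) x.
Proof.
move=> [U [oU Ux] sf] [U' [oU' U'x] sg].
have oI : open (U `&` f @^-1` U').
  by apply: open_setI_preimage => // y Uy; exact: (smooth_on_continuous sf).
exists (U `&` f @^-1` U') => //.
apply: (@smooth_on_comp _ _ _ _ _ U') => //; first by move=> y [].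
by apply: smooth_on_sub sf => y [].
Qed.

(** Pairing and the two projections are written as matrix products, so that the smoothness of linear
    maps applies to them. *)
Lemma row_mx_mulmx n p (u : 'rV[R]_n) (v : 'rV[R]_p) :
  row_mx u v = u *m row_mx 1%:M 0 + v *m row_mx 0 1%:M.
Proof. by rewrite !mul_mx_row !mulmx1 !mulmx0 add_row_mx addr0 add0r. Qed.

Lemma smooth_at_row_mx V n p (f : V -> 'rV[R]_n) (g : V -> 'rV[R]_p) x :
  smooth_at f x -> smooth_at g x -> smooth_at (fun y => row_mx (f y) (g y)) x.
Proof.
move=> sf sg; apply: smooth_at_near (smooth_atD (smooth_at_mulmx _ sf)
  (smooth_at_mulmx _ sg)).
by near=> y; rewrite row_mx_mulmx.
Unshelve. all: by end_near. Qed.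

Lemma lsubmx_mulmx n p (v : 'rV[R]_(n + p)) : lsubmx v = v *m col_mx 1%:M 0.
Proof. by rewrite -[v in RHS]hsubmxK mul_row_col mulmx1 mulmx0 addr0. Qed.

Lemma rsubmx_mulmx n p (v : 'rV[R]_(n + p)) : rsubmx v = v *m col_mx 0 1%:M.
Proof. by rewrite -[v in RHS]hsubmxK mul_row_col mulmx1 mulmx0 add0r. Qed.

Lemma smooth_at_lsubmx n p (v : 'rV[R]_(n + p)) : smooth_at lsubmx v.
Proof.
apply: smooth_at_near (smooth_at_mulmx (col_mx 1%:M 0) (smooth_at_id v)).
by near=> y; rewrite lsubmx_mulmx.
Unshelve. all: by end_near. Qed.

Lemma smooth_at_rsubmx n p (v : 'rV[R]_(n + p)) : smooth_at rsubmx v.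
Proof.
apply: smooth_at_near (smooth_at_mulmx (col_mx 0 1%:M) (smooth_at_id v)).
by near=> y; rewrite rsubmx_mulmx.
Unshelve. all: by end_near. Qed.

End SmoothAt.

Section Charts.
Variable R : realType.

(* An atlas without smoothness of the transition maps: this is all that is
   needed of a product atlas. *)
Definition charts n (M : topologicalType) (A : set (chart R n M)) : Prop :=
  (forall c, A c -> is_chart c) /\ forall x, exists2 c, A c & chart_dom c x.

Lemma smooth_atlas_charts n (M : topologicalType) (A : set (chart R n M)) :
  is_smooth_atlas A -> charts A.
Proof. by case. Qed.

Section OneChart.
Variables (n : nat) (M : topologicalType) (c : chart R n M).
Hypothesis chart_c : is_chart c.

Lemma chart_invK x : chart_dom c x -> chart_inv c (c x) = x.
Proof. by case: chart_c => _ _ + _ _; exact. Qed.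

Lemma chart_continuous x : chart_dom c x -> {for x, continuous c}.
Proof. by case: chart_c => _ _ _ + _; exact. Qed.

Lemma chart_inv_continuous x : chart_dom c x -> {for c x, continuous (chart_inv c)}.
Proof. by case: chart_c => _ _ _ _ + dx; apply; exists x. Qed.

Lemma chart_open_image (O : set M) : open O -> O `<=` chart_dom c -> open (c @` O).
Proof.
move=> oO sO; have [_ oi K _ ci] := chart_c.
rewrite (_ : c @` O = (c @` chart_dom c) `&` (chart_inv c @^-1` O)).
  by apply: open_setI_preimage.
apply/seteqP; split=> [_ [x Ox <-]|_ [[x dx <-] /=]].
  by split; [exists x => //; exact: sO|rewrite /= K //; exact: sO].
by rewrite K // => Ox; exists x.
Qed.

(** Transports a property from near [x] to chart coordinates, where identities between
    representatives are checked. *)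
Lemma near_chart_inv x (P : set M) : chart_dom c x -> nbhs x P ->
  \forall v \near c x, (c @` chart_dom c) v /\ P (chart_inv c v).
Proof.
move=> dx nP; have [_ oi K _ _] := chart_c.
have n1 : nbhs (c x) (c @` chart_dom c) by apply: open_nbhs_nbhs; split=> //; exists x.
have n2 : nbhs (c x) (chart_inv c @^-1` P).
  by apply: (chart_inv_continuous dx); rewrite /= K.
exact: filterI.
Qed.

Lemma chart_dom_nbhs x : chart_dom c x -> nbhs x (chart_dom c).
Proof. by move=> dx; apply: open_nbhs_nbhs; split=> //; case: chart_c. Qed.

End OneChart.

Lemma row_mx_continuous (T : topologicalType) n p (f : T -> 'rV[R]_n)
    (g : T -> 'rV[R]_p) x : {for x, continuous f} -> {for x, continuous g} ->
  {for x, continuous (fun y => row_mx (f y) (g y))}.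
Proof.
move=> cf cg.
have cm m (Q : 'M[R]_(m, n + p)) (v : 'rV[R]_m) :
    {for v, continuous (fun w : 'rV[R]_m => w *m Q)}.
  by have [/differentiable_continuous] := is_diff_mulmxr Q v.
rewrite (_ : (fun y => _) =
  fun y => f y *m row_mx 1%:M 0 + g y *m row_mx 0 1%:M); last first.
  by apply/funext => y; exact: row_mx_mulmx.
apply: continuousD; first exact: (continuous_comp cf (cm _ _ _)).
exact: (continuous_comp cg (cm _ _ _)).
Qed.

Lemma prod_is_chart n p (M N : topologicalType) (c : chart R n M) (d : chart R p N) :
  is_chart c -> is_chart d -> is_chart (prod_chart c d).
Proof.
move=> hc hd; have [oc oic cK cc cic] := hc; have [od oid dK cd cid] := hd.
have lc (v : 'rV[R]_(n + p)) : {for v, continuous lsubmx}.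
  by have [] := smooth_atW (smooth_at_lsubmx v).
have rc (v : 'rV[R]_(n + p)) : {for v, continuous rsubmx}.
  by have [] := smooth_atW (smooth_at_rsubmx v).
split=> /=.
- rewrite openE => -[x y] [/= dx dy].
  exists (chart_dom c, chart_dom d) => //.
  by split; exact: chart_dom_nbhs.
- rewrite (_ : _ @` _ = (setT `&` lsubmx @^-1` (c @` chart_dom c)) `&`
    rsubmx @^-1` (d @` chart_dom d)).
    apply: open_setI_preimage => //.
    by apply: open_setI_preimage => //; exact: openT.
  apply/seteqP; split=> [_ [[x y] [/= dx dy] <-]|v [[_ [x dx xE]] [y dy yE]]].
    by rewrite /= row_mxKl row_mxKr; split; [split=> //; exists x|exists y].
  exists (x, y) => //=.
  by rewrite xE yE hsubmxK.
- by move=> [x y] [/= dx dy]; rewrite row_mxKl row_mxKr cK // dK.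
- move=> [x y] [/= dx dy]; apply: row_mx_continuous.
    by apply: (@continuous_comp _ _ _ fst c); [exact: cvg_fst|exact: cc].
  by apply: (@continuous_comp _ _ _ snd d); [exact: cvg_snd|exact: cd].
- move=> _ [[x y] [/= dx dy] <-]; set v := row_mx _ _.
  have c1 : {for v, continuous (chart_inv c \o lsubmx)}.
    apply: continuous_comp; first exact: lc.
    by rewrite row_mxKl; apply: cic; exists x.
  have c2 : {for v, continuous (chart_inv d \o rsubmx)}.
    apply: continuous_comp; first exact: rc.
    by rewrite row_mxKr; apply: cid; exists y.
  exact: (cvg_pair c1 c2).
Qed.

Lemma prod_charts n p (M N : topologicalType) (A : set (chart R n M))
  (B : set (chart R p N)) : charts A -> charts B -> charts (prod_atlas A B).
Proof.
move=> [hA cA] [hB cB]; split=> [_ [c [d [Ac Bd ->]]]|[x y]].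
  by apply: prod_is_chart; [exact: hA|exact: hB].
have [c Ac dx] := cA x; have [d Bd dy] := cB y.
by exists (prod_chart c d) => //; exists c, d.
Qed.

End Charts.

Section SmoothMapAt.
Variable R : realType.

(** The pointwise form of [smooth_map_on]; quantifying over all charts around the point makes the
    two equivalent for any [charts], without compatibility. *)
Definition smooth_map_at n p (M N : topologicalType) (A : set (chart R n M))
    (B : set (chart R p N)) (f : M -> N) (x : M) : Prop :=
  {for x, continuous f} /\
  forall c d, A c -> B d -> chart_dom c x -> chart_dom d (f x) ->
    smooth_at (chart_rep c d f) (c x).

Lemma smooth_map_onP n p (M N : topologicalType) (A : set (chart R n M))
    (B : set (chart R p N)) (U : set M) (f : M -> N) :
  charts A -> charts B -> open U ->
  smooth_map_on A B U f <-> forall x, U x -> smooth_map_at A B f x.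
Proof.
move=> [hA _] [hB _] oU; split=> [[cf sf] x Ux|H].
  split; first exact: cf.
  move=> c d Ac Bd cx dfx; apply: smooth_on_at (sf _ _ Ac Bd); last by exists x.
  have hc := hA _ Ac; have [oc _ _ _ _] := hc; have [od _ _ _ _] := hB _ Bd.
  apply: chart_open_image => //; last by move=> y [[]].
  rewrite -setIA (setIC (chart_dom c)) setIA; apply: openI => //.
  exact: open_setI_preimage.
split=> [x Ux|c d Ac Bd]; first by have [] := H _ Ux.
apply: smooth_on_local => _ [x [[Ux cx] dfx] <-].
have [_ /(_ _ _ Ac Bd cx dfx)[W [oW Wx] sW]] := H _ Ux.
by exists W.
Qed.

Lemma smooth_mapP n p (M N : topologicalType) (A : set (chart R n M))
    (B : set (chart R p N)) (f : M -> N) : charts A -> charts B ->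
  smooth_map A B f -> forall x, smooth_map_at A B f x.
Proof. by move=> hA hB /(smooth_map_onP f hA hB openT) H x; exact: H. Qed.

Lemma smooth_map_at_near n p (M N : topologicalType) (A : set (chart R n M))
    (B : set (chart R p N)) (f g : M -> N) x : charts A ->
  {near x, f =1 g} -> smooth_map_at A B f x -> smooth_map_at A B g x.
Proof.
move=> [hA _] fg [cf sf]; have fgx := nbhs_singleton fg.
split.
  rewrite /prop_for /continuous_at -fgx.
  exact: cvg_trans (near_eq_cvg fg) cf.
move=> c d Ac Bd cx dgx; have hc := hA _ Ac.
apply: smooth_at_near (sf c d Ac Bd cx _); last by rewrite fgx.
have := near_chart_inv hc cx fg.
by apply: filterS => v [_]; rewrite /chart_rep /= => ->.
Qed.

Lemma smooth_map_at_comp n p q (M N P : topologicalType) (A : set (chart R n M))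
    (B : set (chart R p N)) (C : set (chart R q P)) (f : M -> N) (g : N -> P) x :
  charts A -> charts B -> smooth_map_at A B f x ->
  smooth_map_at B C g (f x) -> smooth_map_at A C (g \o f) x.
Proof.
move=> [hA _] [hB cB] [cf sf] [cg sg]; split; first exact: continuous_comp.
move=> c d Ac Cd cx dgfx; have [e Be efx] := cB (f x).
have hc := hA _ Ac; have he := hB _ Be.
apply: (@smooth_at_near _ _ _ (chart_rep e d g \o chart_rep c e f)); last first.
  apply: smooth_at_comp; first exact: sf.
  by rewrite /chart_rep /= (chart_invK hc) //; exact: sg.
have := near_chart_inv hc cx (cf _ (chart_dom_nbhs he efx)).
by apply: filterS => v [_ /= ev]; rewrite /chart_rep /= (chart_invK he).
Qed.

Lemma smooth_map_at_cst n p (M N : topologicalType) (A : set (chart R n M))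
    (B : set (chart R p N)) (y : N) x : smooth_map_at A B (cst y) x.
Proof. by split=> [|c d _ _ _ _]; [exact: cvg_cst|exact: (smooth_at_cst (d y))]. Qed.

(** The representatives of [id] are the transition maps: compatibility of the atlas enters here, and
    later arguments obtain it through this lemma. *)
Lemma smooth_map_at_id n (M : topologicalType) (A : set (chart R n M)) x :
  is_smooth_atlas A -> smooth_map_at A A id x.
Proof.
move=> [hA cA tA]; split=> [|c d Ac Ad cx dx]; first exact: cvg_id.
apply: smooth_on_at (tA c d Ac Ad); last by exists x.
have hc := hA _ Ac; have [oc _ _ _ _] := hc; have [od _ _ _ _] := hA _ Ad.
by apply: (chart_open_image hc); [exact: openI|move=> y []].
Qed.

Lemma smooth_map_at_pair n p q (M N P : topologicalType) (A : set (chart R n M))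
    (B : set (chart R p N)) (C : set (chart R q P)) (f : M -> N) (g : M -> P) x :
  smooth_map_at A B f x -> smooth_map_at A C g x ->
  smooth_map_at A (prod_atlas B C) (fun y => (f y, g y)) x.
Proof.
move=> [cf sf] [cg sg]; split; first exact: (cvg_pair cf cg).
move=> c _ Ac [d [e [Bd Ce ->]]] cx [/= dfx egx].
by apply: smooth_at_row_mx; [exact: sf|exact: sg].
Qed.

Lemma smooth_map_at_fst n p (M N : topologicalType) (A : set (chart R n M))
    (B : set (chart R p N)) z : is_smooth_atlas A ->
  smooth_map_at (prod_atlas A B) A fst z.
Proof.
move=> sA; split; first exact: cvg_fst.
move=> _ d [c [e [Ac Be ->]]] Ad [/= cz ez] dz.
have [_ /(_ _ _ Ac Ad cz dz) st] := smooth_map_at_id z.1 sA.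
have -> : chart_rep (prod_chart c e) d fst = chart_rep c d id \o lsubmx by [].
apply: smooth_at_comp; first exact: smooth_at_lsubmx.
by rewrite /= row_mxKl.
Qed.

Lemma smooth_map_at_snd n p (M N : topologicalType) (A : set (chart R n M))
    (B : set (chart R p N)) z : is_smooth_atlas B ->
  smooth_map_at (prod_atlas A B) B snd z.
Proof.
move=> sB; split; first exact: cvg_snd.
move=> _ d [c [e [Ac Be ->]]] Bd [/= cz ez] dz.
have [_ /(_ _ _ Be Bd ez dz) st] := smooth_map_at_id z.2 sB.
have -> : chart_rep (prod_chart c e) d snd = chart_rep e d id \o rsubmx by [].
apply: smooth_at_comp; first exact: smooth_at_rsubmx.
by rewrite /= row_mxKr.
Qed.

(** Any other representative is this one between two transition maps. Continuity is a separate
    hypothesis: as [d] is junk off its domain, a smooth representative does not keep [f] inside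
    [chart_dom d]. *)
Lemma smooth_map_at_charts n p (M N : topologicalType) (A : set (chart R n M))
    (B : set (chart R p N)) (f : M -> N) x c d : is_smooth_atlas A ->
  is_smooth_atlas B -> A c -> B d -> chart_dom c x -> chart_dom d (f x) ->
  {for x, continuous f} -> smooth_at (chart_rep c d f) (c x) ->
  smooth_map_at A B f x.
Proof.
move=> sA sB Ac Bd cx dfx cf sf; split=> // c' d' Ac' Bd' c'x d'fx.
have [_ /(_ _ _ Ac' Ac c'x cx) s1] := smooth_map_at_id x sA.
have [_ /(_ _ _ Bd Bd' dfx d'fx) s2] := smooth_map_at_id (f x) sB.
have [hA _ _] := sA; have [hB _ _] := sB.
have hc := hA _ Ac; have hc' := hA _ Ac'; have hd := hB _ Bd.
apply: (@smooth_at_near _ _ _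
    ((chart_rep d d' id \o chart_rep c d f) \o chart_rep c' c id)); last first.
  apply: smooth_at_comp => //.
  have -> : chart_rep c' c id (c' x) = c x by rewrite /chart_rep /= (chart_invK hc').
  apply: smooth_at_comp => //.
  by rewrite /chart_rep /= (chart_invK hc).
have n1 := near_chart_inv hc' c'x (chart_dom_nbhs hc cx).
have n2 := near_chart_inv hc' c'x (cf _ (chart_dom_nbhs hd dfx)).
apply: filterS2 n1 n2 => v [_ /= cv] [_ /= dv].
by rewrite /chart_rep /= (chart_invK hc cv) (chart_invK hd dv).
Qed.

End SmoothMapAt.

(** * Proper actions *)

Section Proper.

Lemma hausdorff_prod (T U : topologicalType) :
  hausdorff_space T -> hausdorff_space U -> hausdorff_space (T * U)%type.
Proof.
move=> hT hU [p1 p2] [q1 q2] cl; congr pair.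
- apply: hT => A B nA nB.
  have nA' : nbhs (p1, p2) (A `*` setT).
    by exists (A, setT) => //; split => //; exact: filterT.
  have nB' : nbhs (q1, q2) (B `*` setT).
    by exists (B, setT) => //; split => //; exact: filterT.
  by have [[y z] [[Ay _] [By _]]] := cl _ _ nA' nB'; exists y.
- apply: hU => A B nA nB.
  have nA' : nbhs (p1, p2) (setT `*` A).
    by exists (setT, A) => //; split => //; exact: filterT.
  have nB' : nbhs (q1, q2) (setT `*` B).
    by exists (setT, B) => //; split => //; exact: filterT.
  by have [[y z] [[_ Az] [_ Bz]]] := cl _ _ nA' nB'; exists z.
Qed.

(** Local compactness: [chart_inv] carries back a closed ball contained in the image of a chart. *)
Lemma chart_compact_nbhs (R : realType) n (M : topologicalType)
    (A : set (chart R n M)) (x : M) :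
  charts A -> exists2 K : set M, nbhs x K & compact K.
Proof.
move=> [hA cA]; have [c Ac cx] := cA x; have hc := hA _ Ac.
have [oc oi K cc ci] := hc.
have /nbhs_closedballP[e eB] : nbhs (c x) (c @` chart_dom c).
  by apply: open_nbhs_nbhs; split=> //; exists x.
exists (chart_inv c @` closed_ball (c x) e%:num).
  have n1 : nbhs x (c @^-1` ball (c x) e%:num).
    by apply: (cc _ cx); exact: nbhsx_ballx.
  apply: filterS2 n1 (chart_dom_nbhs hc cx) => y By cy.
  exists (c y); last exact: K.
  exact: (@subset_closure _ (ball (c x) e%:num)).
apply: continuous_compact.
  by apply: continuous_in_subspaceT => v /set_mem /eB; exact: ci.
apply: bounded_closed_compact; last exact: closed_ball_closed.
exists (`|c x| + e%:num); split; first exact: num_real.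
move=> m lm u; rewrite closed_ballE // /closed_ball_ /= => Ku.
apply: le_trans (ltW lm); rewrite -[u](subKr (c x)).
by apply: le_trans (ler_normB _ _) _; rewrite lerD2l.
Qed.

(* The part of the compact set [[set (g, z) | K z /\ K (a g z)]] lying over the
   complement of [W] has a compact image under [(g, z) |-> (a g z, z)], which
   misses [(x, x)] because the action is free. *)
Lemma proper_free_near (G : groupTopologicalType) (X : topologicalType)
    (a : left_action G X) (x : X) (K : set X) (W : set G) :
  hausdorff_space X -> free_action a -> proper_action a ->
  nbhs x K -> compact K -> nbhs 1%g W ->
  exists2 N, nbhs x N & forall g z, N z -> N (a g z) -> W g.
Proof.
move=> hX fa [cP pP] nK cK nW.
have [W0 [oW W1] W0W] : exists2 B, open_nbhs 1%g B & B `<=` W.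
  by move: nW; rewrite nbhsE.
set P := (fun _ => _) in cP pP.
have cL := pP _ (compact_setX cK cK).
pose L := P @^-1` (K `*` K) `&` ~` (fst @^-1` W0).
have oW' : open (fst @^-1` W0 : set (G * X)).
  by apply: open_comp => // z _; exact: cvg_fst.
have cL' : compact L by apply: compact_closedI => //; exact: open_closedC.
(* The image is compact in a Hausdorff space, hence closed, so its complement is a neighborhood of
   [(x, x)]. *)
have clI : closed (P @` L).
  apply: compact_closed; first exact: hausdorff_prod.
  by apply: continuous_compact => //; exact: continuous_subspaceT.
have nxx : nbhs (x, x) (~` (P @` L)).
  apply: open_nbhs_nbhs; split; first exact: closed_openC.
  move=> [[g z] [_ /= nW0z]]; rewrite /P /= => -[gz zx]; apply: nW0z.
  by rewrite zx in gz; rewrite (fa _ _ gz).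
have [[N1 N2] [/= n1 n2] sN] := nxx.
(* [K] puts [(g, z)] in the compact preimage; [N1] and [N2] keep [(a g z, z)] off the image of
   [L]. *)
exists ((N1 `&` N2) `&` K); first by apply: filterI => //; exact: filterI.
move=> g z [[_ N2z] Kz] [[N1gz _] Kgz]; apply: W0W.
apply/not_notP => nW0g.
have := sN (a g z, z) (conj N1gz N2z).
apply; exists (g, z) => //; split => //.
Qed.

End Proper.

(** * Jacobians in charts, and smoothness as an open condition *)

Section ChartJacobian.
Variable R : realType.

(** Jacobians act on row vectors from the right, so the factors stand in the order of
    application. *)
Lemma jacobian_chart_comp n p q (M N P : topologicalType) (A : set (chart R n M))
    (B : set (chart R p N)) (C : set (chart R q P)) (f : M -> N) (g : N -> P) x
    c d e : charts A -> charts B -> A c -> B d -> C e ->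
  chart_dom c x -> chart_dom d (f x) -> chart_dom e (g (f x)) ->
  smooth_map_at A B f x -> smooth_map_at B C g (f x) ->
  jacobian (chart_rep c e (g \o f)) (c x) =
  jacobian (chart_rep c d f) (c x) *m jacobian (chart_rep d e g) (d (f x)).
Proof.
move=> [hA _] [hB _] Ac Bd Ce cx dfx egfx [cf sf] [cg sg].
have hc := hA _ Ac; have hd := hB _ Bd.
have [_ df] := smooth_atW (sf _ _ Ac Bd cx dfx).
have [_ dg] := smooth_atW (sg _ _ Bd Ce dfx egfx).
have fx : chart_rep c d f (c x) = d (f x) by rewrite /chart_rep /= (chart_invK hc).
rewrite -fx in dg.
have [|_ ->] := jacobian_near (is_diff_comp_jacobian df dg) (g := chart_rep c e (g \o f)).
  have := near_chart_inv hc cx (cf _ (chart_dom_nbhs hd dfx)).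
  by apply: filterS => v [_ /= dv]; rewrite /chart_rep /= (chart_invK hd).
by rewrite fx.
Qed.

Lemma jacobian_chart_id n (M : topologicalType) (A : set (chart R n M)) x c :
  charts A -> A c -> chart_dom c x -> jacobian (chart_rep c c id) (c x) = 1%:M.
Proof.
move=> [hA _] Ac cx.
have [|_ -> //] := jacobian_near (is_diff_id_jacobian (c x)) (g := chart_rep c c id).
have nT : nbhs x setT by exact: filterT.
have := near_chart_inv (hA _ Ac) cx nT.
by apply: filterS => _ [[y cy <-] _]; rewrite /chart_rep /= (chart_invK (hA _ Ac)).
Qed.

(** Continuity is given at [x] only, but it keeps [f] inside [chart_dom d] near [x]; there [f] is
    recovered from its smooth representative and is therefore continuous as well. *)
Lemma near_smooth_map_at n p (M N : topologicalType) (A : set (chart R n M))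
    (B : set (chart R p N)) (f : M -> N) x :
  is_smooth_atlas A -> is_smooth_atlas B -> smooth_map_at A B f x ->
  \forall y \near x, smooth_map_at A B f y.
Proof.
move=> sA sB [cf sf]; have [hA cA _] := sA; have [hB cB _] := sB.
have [c Ac cx] := cA x; have [d Bd dfx] := cB (f x).
have hc := hA _ Ac; have hd := hB _ Bd.
have [W [oW Wx] sW] := sf _ _ Ac Bd cx dfx.
have n1 := chart_dom_nbhs hc cx.
have n2 : nbhs x (f @^-1` chart_dom d) by exact: (cf _ (chart_dom_nbhs hd dfx)).
have n3 : nbhs x (c @^-1` W).
  by apply: (chart_continuous hc cx); exact: open_nbhs_nbhs.
have : nbhs x (chart_dom c `&` f @^-1` chart_dom d `&` c @^-1` W).
  by apply: filterI => //; exact: filterI.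
rewrite nbhsE => -[Y [oY Yx] sY]; rewrite /prop_near1 nbhsE; exists Y => // y Yy.
have [[cy dfy] Wy] := sY _ Yy.
apply: (smooth_map_at_charts sA sB Ac Bd cy dfy); last exact: smooth_on_at sW.
have cr : {for y, continuous (chart_inv d \o (chart_rep c d f \o c))}.
  apply: continuous_comp.
    apply: continuous_comp; first exact: chart_continuous.
    exact: (smooth_on_continuous sW).
  by rewrite /chart_rep /= (chart_invK hc) //; exact: (chart_inv_continuous hd).
have E z : Y z -> (chart_inv d \o (chart_rep c d f \o c)) z = f z.
  by move=> /sY[[cz dfz] _]; rewrite /chart_rep /= (chart_invK hc) ?(chart_invK hd).
rewrite /prop_for /continuous_at -(E _ Yy).
apply: cvg_trans cr; apply: near_eq_cvg.
by move=> /=; near=> z; apply: E; near: z; exact: open_nbhs_nbhs.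
Unshelve. all: by end_near. Qed.

End ChartJacobian.

(** * Local sections and orbit maps *)

Section LocalSection.
Variable R : realType.

Lemma is_diff_affine n p (y0 : 'rV[R]_p) (Q : 'M[R]_(n, p)) (w0 w : 'rV[R]_n) :
  is_diff w (fun v => y0 + (v - w0) *m Q) (mulmx^~ Q).
Proof.
have dq := is_diff_mulmxr Q w.
have d3 := is_diffD (is_diff_cst (y0 - w0 *m Q) w) dq.
have -> : (fun v : 'rV[R]_n => y0 + (v - w0) *m Q) =
    cst (y0 - w0 *m Q) + mulmx^~ Q.
  by apply/funext => v; rewrite !fctE mulmxBl addrAC addrA.
by apply: (is_diff_eq d3); apply/funext => v; rewrite !fctE add0r.
Qed.

Lemma smooth_on_affine n p (y0 : 'rV[R]_p) (Q : 'M[R]_(n, p)) (w0 : 'rV[R]_n) :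
  smooth_on setT (fun v => y0 + (v - w0) *m Q).
Proof.
have oT := @openT 'rV[R]_n.
apply: smooth_onD => //; first exact: smooth_on_cst.
apply: smooth_on_mulmx => //; apply: smooth_onD => //; first exact: smooth_on_id.
exact: smooth_on_cst.
Qed.

(** Restricted to an affine slice [l] transverse to the fiber, the representative of [f] has
    differential [id]; the section is the slice after the local inverse [H]. *)
Lemma submersion_local_section n p (M N : topologicalType) (A : set (chart R n M))
    (B : set (chart R p N)) (f : M -> N) x :
  is_smooth_atlas A -> is_smooth_atlas B -> smooth_submersion A B f ->
  exists (V : set N) (s : N -> M), [/\ open V, V (f x), s (f x) = x,
    forall y, V y -> f (s y) = y & forall y, V y -> smooth_map_at B A s y].
Proof.
move=> sA sB [smf surj]; have [hA cA _] := sA; have [hB cB _] := sB.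
have sf y : smooth_map_at A B f y.
  by apply: smooth_mapP => //; exact: smooth_atlas_charts.
have [c Ac cx] := cA x; have [d Bd dfx] := cB (f x).
have hc := hA _ Ac; have hd := hB _ Bd.
have [oc oic cK cc cic] := hc; have [od oid dK cd cid] := hd.
pose fh := chart_rep c d f.
have [U1 [oU1 U1x] sU1] : smooth_at fh (c x) by exact: (sf x).2.
have oD : open (chart_dom c `&` f @^-1` chart_dom d).
  by apply: open_setI_preimage => // y _; exact: (sf y).1.
pose U := U1 `&` c @` (chart_dom c `&` f @^-1` chart_dom d).
have oU : open U.
  by apply: openI => //; apply: (chart_open_image hc oD) => y [].
have Ux : U (c x) by split=> //; exists x.
have sU : smooth_on U fh by apply: smooth_on_sub sU1 => v [].
have [S SJ] : exists S, S *m jacobian fh (c x) = 1%:M.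
  apply/row_fullP/row_fullP.
  have /fin_all_exists[v vE] : forall i : 'I_p, exists v : 'rV[R]_n,
      v *m jacobian fh (c x) = delta_mx 0 i.
    move=> i; have [v vE] := surj x c d Ac Bd cx dfx (delta_mx 0 i).
    by exists v; rewrite -diffEjacobian.
  exists (\matrix_i v i); apply/row_matrixP => i.
  by rewrite row_mul rowK vE row1.
pose w0 := d (f x).
pose l (w : 'rV[R]_p) : 'rV[R]_n := c x + (w - w0) *m S.
have l0 : l w0 = c x by rewrite /l subrr mul0mx addr0.
have sl : smooth_on setT l by exact: smooth_on_affine.
have cl w : {for w, continuous l} by exact: (smooth_on_continuous sl).
pose U' := [set: 'rV[R]_p] `&` l @^-1` U.
have oU' : open U' by apply: open_setI_preimage => //; exact: openT.
have U'w0 : U' w0 by split=> //=; rewrite l0.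
have sF : smooth_on U' (fh \o l).
  apply: (@smooth_on_comp _ _ _ _ _ U) => //; first by move=> w [].
  exact: smooth_on_sub sl.
have dF0 v : 'd (fh \o l) w0 v = v.
  have [dl dlE] := is_diff_affine (c x) S w0 w0.
  have dfh : differentiable fh (l w0).
    by rewrite l0; exact: smooth_on_differentiable sU Ux.
  by rewrite (diff_comp dl dfh) /= dlE diffEjacobian -/(l w0) l0 -mulmxA SJ mulmx1.
have [H [e [r [[e0 r0] HU HP HF sH]]]] := inverse_function oU' U'w0 sF dF0.
have F0 : (fh \o l) w0 = w0 by rewrite /= l0 /fh /chart_rep /= cK.
rewrite F0 in HP sH.
pose s y := chart_inv c (l (H (d y))).
pose V := chart_dom d `&` d @^-1` ball w0 r.
have oB : open (ball w0 r) by exact: ball_open.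
have Hw0 : H w0 = w0 by rewrite -{1}F0; apply: HF; exact: ballxx.
(* Guarantees that [l (H w)] comes from a point where neither [c] nor [d] takes a junk value. *)
have lH w : ball w0 r w -> exists x', [/\ chart_dom c x', chart_dom d (f x'),
    c x' = l (H w) & d (f x') = w].
  move=> Bw; have [Be FH] := HP _ Bw; have [[_ [_ [x' [cx' dx'] x'E]]] _] := HU _ Be.
  exists x'; split=> //.
  by rewrite -[RHS]FH /= -x'E /fh /chart_rep /= cK.
exists V, s; split.
- exact: open_setI_preimage.
- by split=> //=; exact: ballxx.
- by rewrite /s -/w0 Hw0 l0 cK.
- move=> y [dy By]; have [x' [cx' dx' x'E x'y]] := lH _ By.
  rewrite /s -x'E cK //.
  by rewrite -(dK _ dx') x'y dK.
move=> y [dy By]; have [x' [cx' dx' x'E x'y]] := lH _ By.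
have sy : s y = x' by rewrite /s -x'E cK.
have slH : smooth_on (ball w0 r) (l \o H).
  by apply: (@smooth_on_comp _ _ _ _ _ setT).
have cs : {for y, continuous s}.
  apply: (@continuous_comp _ _ _ ((l \o H) \o d) (chart_inv c)).
    by apply: continuous_comp; [exact: cd|exact: (smooth_on_continuous slH)].
  by rewrite /= -x'E; apply: cic; exists x'.
apply: (smooth_map_at_charts sB sA Bd Ac dy _ cs); first by rewrite sy.
apply: (@smooth_at_near _ _ _ (l \o H)); last exact: (smooth_on_at oB By slH).
have nB : nbhs y (d @^-1` ball w0 r).
  by apply: (cd _ dy); exact: open_nbhs_nbhs.
have := near_chart_inv hd dy nB.
apply: filterS => _ [[z dz <-]] /=; rewrite dK // => Bz.
have [z' [cz' _ z'E _]] := lH _ Bz.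
by rewrite /chart_rep /= /s dK // -z'E cK.
Qed.

End LocalSection.

Lemma mxrank_unit_mul (F : fieldType) m n (A : 'M[F]_m) (B C : 'M[F]_(m, n))
    (D : 'M[F]_n) : A \in unitmx -> D \in unitmx -> B *m D = A *m C ->
  \rank C = \rank B.
Proof.
rewrite -row_full_unit -row_free_unit => fA fD E.
by rewrite -(mxrankMfree B fD) E eqmxMfull.
Qed.

Section Orbits.
Variables (R : realType) (n k : nat) (X : topologicalType) (AX : set (chart R n X)).
Variables (G : groupTopologicalType) (AG : set (chart R k G)) (a : left_action G X).
Hypotheses (sX : is_smooth_atlas AX) (sG : is_smooth_atlas AG).
Hypothesis sm : smooth_map (prod_atlas AG AG) AG (fun z : G * G => (z.1 * z.2)%g).
Hypothesis sa : smooth_action AG AX a.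

Let hX : charts AX := smooth_atlas_charts sX.
Let hG : charts AG := smooth_atlas_charts sG.

Lemma smooth_map_at_mulgl g h : smooth_map_at AG AG (fun h' => (g * h')%g) h.
Proof.
have hGG := prod_charts hG hG.
apply: (@smooth_map_at_comp _ _ _ _ _ _ _ AG (prod_atlas AG AG) AG
  (fun h' => (g, h')) (fun z : G * G => (z.1 * z.2)%g)) => //.
  by apply: smooth_map_at_pair; [exact: smooth_map_at_cst|exact: smooth_map_at_id].
exact: smooth_mapP.
Qed.

Lemma smooth_map_at_act n' (Y : topologicalType) (AY : set (chart R n' Y))
    (f : Y -> G) (s : Y -> X) y : charts AY ->
  smooth_map_at AY AG f y -> smooth_map_at AY AX s y ->
  smooth_map_at AY AX (fun y => a (f y) (s y)) y.
Proof.
move=> hY sf ss; have hGX := prod_charts hG hX.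
apply: (@smooth_map_at_comp _ _ _ _ _ _ _ AY (prod_atlas AG AX) AX
  (fun y => (f y, s y)) (fun z : G * X => a z.1 z.2)) => //.
  exact: smooth_map_at_pair.
exact: smooth_mapP.
Qed.

Lemma smooth_map_at_actr g x : smooth_map_at AX AX (a g) x.
Proof.
apply: smooth_map_at_act => //; first exact: smooth_map_at_cst.
exact: smooth_map_at_id.
Qed.

Lemma smooth_map_at_orbit x g : smooth_map_at AG AX (fun g => a g x) g.
Proof.
apply: smooth_map_at_act => //; first exact: smooth_map_at_id.
exact: smooth_map_at_cst.
Qed.

(** The chain rule for [g \o f = id]; with one chart at both points the Jacobian is square, so a
    one-sided inverse suffices. *)
Lemma jacobian_chart_inverse n' (M : topologicalType) (A : set (chart R n' M))
    (f g : M -> M) x c : charts A -> A c -> chart_dom c x -> chart_dom c (f x) ->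
  cancel f g -> smooth_map_at A A f x -> smooth_map_at A A g (f x) ->
  jacobian (chart_rep c c f) (c x) \in unitmx.
Proof.
move=> hA Ac cx cfx fK sf sg.
have cgfx : chart_dom c (g (f x)) by rewrite fK.
have := jacobian_chart_comp hA hA Ac Ac Ac cx cfx cgfx sf sg.
have -> : g \o f = id by apply/funext => y /=; rewrite fK.
rewrite (jacobian_chart_id hA Ac cx) => /esym J1.
by rewrite -row_free_unit; apply/row_freeP; exists (jacobian (chart_rep c c g) (c (f x))).
Qed.

Lemma actKV g : cancel (a g) (a g^-1%g).
Proof. by move=> x; rewrite -actM mulVg act1. Qed.

(* Differentiating [a (g * h) x = a g (a h x)] in [h] shows that the rank of the
   orbit map is constant, and freeness makes it injective. *)
Lemma orbit_map_immersion x cG cX : free_action a -> AG cG -> AX cX ->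
  chart_dom cG 1%g -> chart_dom cX x ->
  row_free (jacobian (chart_rep cG cX (fun g => a g x)) (cG 1%g)).
Proof.
move=> fa AcG AcX G1 Xx; set o := fun g => a g x.
have so g : smooth_map_at AG AX o g by exact: smooth_map_at_orbit.
have hcG := hG.1 _ AcG; have hcX := hX.1 _ AcX.
have [oG oiG GK ccG ciG] := hcG; have [oX oiX XK ccX ciX] := hcX.
have oD : open (chart_dom cG `&` o @^-1` chart_dom cX).
  by apply: open_setI_preimage => // g _; exact: (so g).1.
pose U := cG @` (chart_dom cG `&` o @^-1` chart_dom cX).
have oU : open U by apply: (chart_open_image hcG oD) => g [].
have o1 : o 1%g = x by rewrite /o act1.
have U1 : U (cG 1%g) by exists 1%g => //; split=> //=; rewrite o1.
have sU : smooth_on U (chart_rep cG cX o).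
  apply: smooth_on_local => _ [g [gG gX] <-].
  by have [W [oW Wg] sW] := (so g).2 _ _ AcG AcX gG gX; exists W.
apply: (constant_rank_injective oU U1 sU).
  move=> _ [g [/= gG gX] <-].
  pose T h := (g * h)%g.
  have T1 : T 1%g = g by rewrite /T mulg1.
  have sT h : smooth_map_at AG AG T h by exact: smooth_map_at_mulgl.
  have G1' : chart_dom cX (o 1%g) by rewrite o1.
  have T1G : chart_dom cG (T 1%g) by rewrite T1.
  have T1X : chart_dom cX (o (T 1%g)) by rewrite T1.
  have J1 := jacobian_chart_comp (f:=T) (g:=o) hG hG AcG AcG AcX G1 T1G T1X
    (sT 1%g) (so (T 1%g)).
  have ag1 : chart_dom cX (a g (o 1%g)) by rewrite o1.
  have J2 := jacobian_chart_comp (f:=o) (g:=a g) hG hX AcG AcX AcX G1 G1' ag1 (so 1%g)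
    (smooth_map_at_actr g (o 1%g)).
  rewrite T1 in J1; rewrite o1 in J2.
  have TK : cancel T (fun h => (g^-1 * h)%g).
    by move=> h; rewrite /T mulgA mulVg mul1g.
  have UT := jacobian_chart_inverse hG AcG G1 T1G TK (sT 1%g)
    (smooth_map_at_mulgl g^-1%g (T 1%g)).
  have UA := jacobian_chart_inverse (f:=a g) hX AcX Xx gX (actKV g)
    (smooth_map_at_actr g x) (smooth_map_at_actr g^-1%g (a g x)).
  have E : o \o T = a g \o o by apply/funext => h; rewrite /o /T /= actM.
  rewrite E J2 in J1.
  exact: (mxrank_unit_mul UT UA J1).
move=> _ _ [g [gG gX] <-] [h [hG' hX'] <-].
rewrite /chart_rep /= !GK // => oE.
have {}oE : o g = o h by rewrite -(XK _ gX) oE XK.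
congr (cG _); have := fa (h^-1 * g)%g x.
rewrite actM -/(o g) oE /o actKV => /(_ erefl) hg.
by rewrite -[g](mulVKg h) hg mulg1.
Qed.

End Orbits.

Lemma orbit_projP (G : groupType) (X : topologicalType) (a : left_action G X) x y :
  orbit_proj a x = orbit_proj a y <-> exists g, a g x = y.
Proof.
split=> [/eqmodP/asboolP //|H].
by apply/eqmodP/asboolP.
Qed.

(** * The local trivialization *)

Section Bundle.
Variables (R : realType) (n k q : nat).
Variables (X : topologicalType) (AX : set (chart R n X)).
Variables (G : groupTopologicalType) (AG : set (chart R k G)).
Variables (a : left_action G X) (AQ : set (chart R q (orbit_space a))).
Hypotheses (sX : is_smooth_atlas AX) (sG : is_smooth_atlas AG).
Hypothesis sQ : is_smooth_atlas AQ.
Hypothesis sm : smooth_map (prod_atlas AG AG) AG (fun z : G * G => (z.1 * z.2)%g).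
Hypothesis sa : smooth_action AG AX a.
Hypothesis fa : free_action a.
Hypothesis spi : smooth_submersion AX AQ (orbit_proj a).

Let hX : charts AX := smooth_atlas_charts sX.
Let hG : charts AG := smooth_atlas_charts sG.
Let hQ : charts AQ := smooth_atlas_charts sQ.
Let hGQ := prod_charts hG hQ.
Local Notation pi := (orbit_proj a).

Variables (V : set (orbit_space a)) (s : orbit_space a -> X).
Hypotheses (oV : open V) (sK : forall y, V y -> pi (s y) = y).
Hypothesis ss : forall y, V y -> smooth_map_at AQ AX s y.

Let phi (z : G * orbit_space a) := a z.1 (s z.2).

Lemma orbit_proj_act g x : pi (a g x) = pi x.
Proof. by apply/esym/orbit_projP; exists g. Qed.

Lemma smooth_map_at_orbit_proj x : smooth_map_at AX AQ pi x.
Proof. by apply: smooth_mapP => //; case: spi. Qed.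

Lemma smooth_map_at_trivialization_inv z :
  V z.2 -> smooth_map_at (prod_atlas AG AQ) AX phi z.
Proof.
move=> Vz; apply: (smooth_map_at_act sX sG sa (f:=fst) (s:=s \o snd)) => //.
  exact: smooth_map_at_fst.
apply: (smooth_map_at_comp (f:=snd) (g:=s) hGQ hQ); last exact: ss.
exact: smooth_map_at_snd.
Qed.

(* [pi \o phi] is the second projection and [phi] restricts to the orbit map on
   [G * {y0}], so the kernel of the differential of [phi] is trivial. *)
Lemma trivialization_inv_immersion y0 cG cQ cX : AG cG -> AQ cQ -> AX cX ->
  V y0 -> chart_dom cG 1%g -> chart_dom cQ y0 -> chart_dom cX (s y0) ->
  row_free (jacobian (chart_rep (prod_chart cG cQ) cX phi)
    (prod_chart cG cQ (1%g, y0))).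
Proof.
move=> AcG AcQ AcX Vy0 G1 Qy Xs.
have hcG := hG.1 _ AcG; have hcQ := hQ.1 _ AcQ.
pose c := prod_chart cG cQ; have Ac : prod_atlas AG AQ c by exists cG, cQ.
have hc : is_chart c by exact: hGQ.1.
set z0 := (1%g, y0); have cz0 : chart_dom c z0 by split.
have phiz0 : phi z0 = s y0 by rewrite /phi act1.
have Xphi : chart_dom cX (phi z0) by rewrite phiz0.
have sphi : smooth_map_at (prod_atlas AG AQ) AX phi z0.
  exact: smooth_map_at_trivialization_inv.
set D := jacobian _ _.
(* The Jacobian of [pi \o phi], the second projection: [v *m D = 0] forces the base component of [v]
   to vanish. *)
have [J2 D2] : exists J, D *m J = col_mx 0 1%:M.
  have Qpi : chart_dom cQ (pi (phi z0)) by rewrite phiz0 sK.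
  have E := jacobian_chart_comp (f:=phi) (g:=pi) hGQ hX Ac AcX AcQ cz0 Xphi Qpi
    sphi (smooth_map_at_orbit_proj (phi z0)).
  exists (jacobian (chart_rep cX cQ pi) (cX (phi z0))).
  rewrite /D -E.
  have dr := is_diff_mulmxr (col_mx 0 1%:M : 'M[R]_(k + q, q)) (c z0).
  have [|_ -> //] := jacobian_near dr (g := chart_rep c cQ (pi \o phi)).
  have nV : nbhs z0 (snd @^-1` V).
    exists (setT, V); last by move=> z [].
    by split; [exact: filterT|exact: open_nbhs_nbhs].
  have := near_chart_inv hc cz0 nV.
  apply: filterS => _ [[z [/= cz1 cz2] <-]].
  rewrite /chart_rep /= row_mxKl row_mxKr (chart_invK hcG) // (chart_invK hcQ) //.
  by move=> Vz; rewrite /phi orbit_proj_act sK // mul_row_col mulmx0 mulmx1 add0r.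
(* The Jacobian of [phi] restricted to [G * {y0}], that is, of the orbit map of [s y0]; it handles
   the group component of [v]. *)
have [J1 J1D] : exists J, row_mx 1%:M 0 *m D = J /\ row_free J.
  pose i (g : G) := (g, y0).
  have si : smooth_map_at AG (prod_atlas AG AQ) i 1%g.
    by apply: smooth_map_at_pair; [exact: smooth_map_at_id|exact: smooth_map_at_cst].
  have E := jacobian_chart_comp (f:=i) (g:=phi) hG hGQ AcG Ac AcX G1 cz0 Xphi si sphi.
  exists (jacobian (chart_rep cG cX (phi \o i)) (cG 1%g)); split; last first.
    exact: (orbit_map_immersion sX sG sm sa fa AcG AcX G1 Xs).
  rewrite E; congr (_ *m _).
  have di := is_diff_affine (c z0) (row_mx 1%:M 0 : 'M[R]_(k, k + q)) (cG 1%g) (cG 1%g).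
  have [|_ -> //] := jacobian_near di (g := chart_rep cG c i).
  have nT : nbhs (1%g : G) setT by exact: filterT.
  have := near_chart_inv hcG G1 nT.
  apply: filterS => _ [[g gG <-] _].
  rewrite /chart_rep /= (chart_invK hcG) // mul_mx_row mulmx1 mulmx0 add_row_mx.
  by rewrite addrC subrK addr0.
apply: inj_row_free => v vD.
have v2 : rsubmx v = 0 by rewrite rsubmx_mulmx -D2 mulmxA vD mul0mx.
have v1 : lsubmx v *m J1 = 0.
  rewrite -J1D.1 mulmxA mul_mx_row mulmx1 mulmx0.
  by rewrite -[RHS]vD -{2}[v]hsubmxK v2.
have {}v1 : lsubmx v = 0 by apply: (row_free_inj J1D.2); rewrite v1 mul0mx.
by rewrite -[v]hsubmxK v1 v2 row_mx0.
Qed.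

(** The default [1%g] arises when [s (pi x)] is not in the orbit of [x], which cannot happen over
    [V]; freeness makes the element unique. *)
Let chi x := xget 1%g [set g | a g (s (pi x)) = x].

Lemma act_chi x : V (pi x) -> a (chi x) (s (pi x)) = x.
Proof.
move=> Vx; have /orbit_projP[g gE] : pi (s (pi x)) = pi x by rewrite sK.
exact: (@xgetPex _ 1%g [set g | a g (s (pi x)) = x] (ex_intro _ g gE)).
Qed.

Lemma free_act_inj g h x : a g x = a h x -> g = h.
Proof.
move=> E; have : a (h^-1 * g)%g x = x by rewrite actM E actKV.
by move=> /fa hg; rewrite -[g](mulVKg h) hg mulg1.
Qed.

Lemma chi_act g y : V y -> chi (a g (s y)) = g.
Proof.
move=> Vy; have Vp : V (pi (a g (s y))) by rewrite orbit_proj_act sK.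
by have := act_chi Vp; rewrite orbit_proj_act sK // => /free_act_inj.
Qed.

Lemma chi_actM g x : V (pi x) -> chi (a g x) = (g * chi x)%g.
Proof.
by move=> Vx; rewrite -{1}(act_chi Vx) -actM chi_act.
Qed.

(* In charts [phi] is an immersion, so [phi *m D] with [D] a left inverse of its
   Jacobian is locally invertible; its inverse recovers [(chi x', pi x')] from
   [x'] because properness makes [chi] continuous at [x]. *)
Lemma chi_smooth_map_at x : hausdorff_space X -> proper_action a ->
  V (pi x) -> s (pi x) = x -> smooth_map_at AX AG chi x.
Proof.
move=> hausX pa Vx sx; set y0 := pi x in Vx sx.
have [cG AcG G1] := hG.2 1%g; have [cQ AcQ Qy] := hQ.2 y0.
have [cX AcX Xx] := hX.2 x.
have hcG := hG.1 _ AcG; have hcQ := hQ.1 _ AcQ; have hcX := hX.1 _ AcX.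
pose c := prod_chart cG cQ; have Ac : prod_atlas AG AQ c by exists cG, cQ.
have hc : is_chart c by exact: hGQ.1.
pose z0 := (1%g : G, y0); have cz0 : chart_dom c z0 by split.
have phiz0 : phi z0 = x by rewrite /phi act1.
have Xphi : chart_dom cX (phi z0) by rewrite phiz0.
pose ph := chart_rep c cX phi.
have [U [oU Uz0] sU] : smooth_at ph (c z0).
  by apply: (smooth_map_at_trivialization_inv (z:=z0) Vx).2.
have Xs : chart_dom cX (s y0) by rewrite sx.
have /row_freeP[D JD] := trivialization_inv_immersion AcG AcQ AcX Vx G1 Qy Xs.
pose F p := ph p *m D.
have sF : smooth_on U F by exact: smooth_on_mulmx.
have dF0 v : 'd F (c z0) v = v.
  have dph := smooth_on_differentiable sU Uz0.
  have [dD dDE] := is_diff_mulmxr D (ph (c z0)).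
  have -> : F = mulmx^~ D \o ph by [].
  by rewrite (diff_comp dph dD) /= dDE diffEjacobian -mulmxA JD mulmx1.
have [H [e [r [[e0 r0] _ HP HF sH]]]] := inverse_function oU Uz0 sF dF0.
have phz0 : ph (c z0) = cX x by rewrite /ph /chart_rep /comp (chart_invK hc) // phiz0.
have FcX : F (c z0) = cX x *m D by rewrite /F phz0.
(* The candidate for [chi] in charts, defined on the ambient coordinates of [X]; [lsubmx] keeps the
   group coordinates. *)
pose h (u : 'rV[R]_n) := lsubmx (H (u *m D)).
have sh : smooth_at h (cX x).
  apply: (@smooth_at_comp _ _ _ _ (fun u => H (u *m D)) lsubmx);
    last exact: smooth_at_lsubmx.
  apply: (@smooth_at_comp _ _ _ _ (mulmx^~ D) H).
    by apply: smooth_at_mulmx; exact: smooth_at_id.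
  apply: smooth_on_at sH; first exact: ball_open.
  by rewrite FcX; exact: ballxx.
have cpi y : {for y, continuous pi} by exact: (smooth_map_at_orbit_proj y).1.
have npV : nbhs x (pi @^-1` V) by apply: (cpi x); exact: open_nbhs_nbhs.
(* Here [H] inverts [F]; a product neighborhood inside it lets [chi y] and [pi y] be controlled
   separately. *)
have nc : nbhs z0 (chart_dom c `&` c @^-1` ball (c z0) e).
  apply: filterI; first exact: chart_dom_nbhs.
  by apply: (chart_continuous hc cz0); exact: nbhsx_ballx.
have [[W1 W2] [/= nW1 nW2] sW] := nc.
have [K nK cK] := chart_compact_nbhs x hX.
have [N nN NW] := proper_free_near hausX fa pa nK cK nW1.
(* [proper_free_near] is used with [g = chi y] and [z = s (pi y)], for which [a g z = y]; both
   points must lie in [N]. *)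
have nspi : nbhs x [set y | N (s (pi y))].
  have cspi : {for x, continuous (s \o pi)}.
    by apply: continuous_comp; [exact: cpi|exact: (ss Vx).1].
  by apply: (cspi N); rewrite /= -/y0 sx.
have near_h : \forall y \near x, chart_dom cG (chi y) /\ cG (chi y) = h (cX y).
  have nW2' : nbhs x (pi @^-1` W2) by exact: (cpi x _ nW2).
  near=> y.
  have Vy : V (pi y) by near: y; exact: npV.
  have Ny : N y by near: y; exact: nN.
  have Nsy : N (s (pi y)) by near: y; exact: nspi.
  have W2y : W2 (pi y) by near: y; exact: nW2'.
  have W1y : W1 (chi y) by apply: (NW _ _ Nsy); rewrite act_chi.
  have [[/= chG chQ] Be] := sW (chi y, pi y) (conj W1y W2y).
  split=> //; have := HF _ Be.
  rewrite /F /ph {1}/chart_rep /= row_mxKl row_mxKr (chart_invK hcG) //.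
  rewrite (chart_invK hcQ) // /phi /= act_chi // /h => ->.
  by rewrite row_mxKl.
have chi1 : chi x = 1%g.
  by have := chi_act 1%g Vx; rewrite sx act1.
have chG : chart_dom cG (chi x) by rewrite chi1.
apply: (smooth_map_at_charts sX sG AcX AcG Xx chG).
  have hx : h (cX x) = cG 1%g.
    by have [_ <-] := nbhs_singleton near_h; rewrite chi1.
  have ch : {for x, continuous (chart_inv cG \o (h \o cX))}.
    apply: continuous_comp.
      apply: continuous_comp; first exact: chart_continuous.
      exact: (smooth_atW sh).1.
    by rewrite /= hx; exact: (chart_inv_continuous hcG).
  have chE : \forall y \near x, (chart_inv cG \o (h \o cX)) y = chi y.
    by apply: filterS near_h => y [chy /= <-]; rewrite (chart_invK hcG).
  rewrite /prop_for /continuous_at -(nbhs_singleton chE).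
  exact: cvg_trans (near_eq_cvg chE) ch.
apply: smooth_at_near sh.
have := near_chart_inv hcX Xx near_h.
apply: filterS => _ [[y Xy <-]]; rewrite /chart_rep /= (chart_invK hcX) //.
by case=> _ ->.
Unshelve. all: by end_near. Qed.

Lemma chi_smooth_map_at_translate g y : V y ->
  smooth_map_at AX AG chi (s y) -> smooth_map_at AX AG chi (a g (s y)).
Proof.
move=> Vy sy; set x := a g (s y).
have cpi : {for x, continuous pi} by exact: (smooth_map_at_orbit_proj x).1.
have npV : nbhs x (pi @^-1` V).
  by apply: (cpi V); rewrite /x orbit_proj_act sK //; exact: open_nbhs_nbhs.
(* The identity [chi x' = g * chi (a g^-1 x')] holds over [V], which is a neighborhood upstairs, so
   the two germs agree. *)
apply: (@smooth_map_at_near _ _ _ _ _ AX AG (fun x' => g * chi (a g^-1 x'))%g chi x hX).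
  apply: filterS npV => x' Vx' /=.
  by rewrite -chi_actM -?actM ?mulgV ?act1 ?orbit_proj_act.
have sgy : smooth_map_at AX AG chi (a g^-1%g x) by rewrite /x actKV.
have s1 := smooth_map_at_comp hX hX (smooth_map_at_actr sX sG sa g^-1%g x) sgy.
exact: (smooth_map_at_comp hX hG s1 (smooth_map_at_mulgl sG sm g _)).
Qed.

End Bundle.

Theorem theorem5p6 (R : realType) (n k q : nat)
    (X : topologicalType) (AX : set (chart R n X))
    (G : groupTopologicalType) (AG : set (chart R k G))
    (a : left_action G X) (AQ : set (chart R q (orbit_space a)))
    (X_manifold : smooth_manifold AX)
    (G_lie : lie_group AG)
    (a_smooth : smooth_action AG AX a)
    (a_free : free_action a)
    (a_proper : proper_action a)
    (Q_manifold : smooth_manifold AQ)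
    (pi_submersion : smooth_submersion AX AQ (orbit_proj a)) :
  forall x : X,
    exists (V : set (orbit_space a)) (psi : X -> G * orbit_space a)
           (chi : X -> G),
      [/\ open V,
          V (orbit_proj a x),
          diffeomorphism_on AX (prod_atlas AG AQ)
            (orbit_proj a @^-1` V) (setT `*` V) psi,
          forall x', V (orbit_proj a x') ->
            psi x' = (chi x', orbit_proj a x') &
          forall g x', V (orbit_proj a x') ->
            psi (a g x') = ((g * chi x')%g, orbit_proj a x')].
Proof.
move=> x; have [hausX _ sX] := X_manifold; have [[_ _ sG] sm _] := G_lie.
have [_ _ sQ] := Q_manifold.
have hX := smooth_atlas_charts sX; have hG := smooth_atlas_charts sG.
have hQ := smooth_atlas_charts sQ; have hGQ := prod_charts hG hQ.
have [V0 [s [oV0 V0x sx sK ss]]] := submersion_local_section x sX sQ pi_submersion.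
pose chi y := xget 1%g [set g | a g (s (orbit_proj a y)) = y].
have schi : smooth_map_at AX AG chi x.
  exact: (chi_smooth_map_at sX sG sQ sm a_smooth a_free pi_submersion oV0 sK ss).
have := near_smooth_map_at sX sG schi.
rewrite /prop_near1 nbhsE => -[Y [oY Yx] sY].
(* Every orbit over [V] meets, at [s y], the open set [Y] where [chi] is smooth. *)
pose V := V0 `&` s @^-1` Y.
have VV0 y : V y -> V0 y by case.
have oV : open V by apply: open_setI_preimage => // y /ss[].
have sKV y : V y -> orbit_proj a (s y) = y by move=> /VV0/sK.
have spi y : smooth_map_at AX AQ (orbit_proj a) y.
  exact: smooth_map_at_orbit_proj.
have opiV : open (orbit_proj a @^-1` V).
  by apply: open_comp => // y _; exact: (spi y).1.
exists V, (fun y => (chi y, orbit_proj a y)), chi; split => //.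
- by split=> //=; rewrite sx.
- split.
    apply/smooth_map_onP => // y Vy; apply: smooth_map_at_pair; last exact: spi.
    (* Presents [y] as a translate of [s (orbit_proj a y)], a point of [Y]. *)
    rewrite -[y](act_chi sKV Vy).
    apply: (chi_smooth_map_at_translate sX sG sQ sm a_smooth a_free pi_submersion
      oV0 sK); first exact: VV0.
    by apply: sY; case: Vy.
  exists (fun z => a z.1 (s z.2)); split.
  + apply/smooth_map_onP => //.
      rewrite (_ : _ `*` _ = snd @^-1` V); last by apply/seteqP; split=> z // [].
      by apply: open_comp => // z _; exact: cvg_snd.
    move=> z [_ /VV0 Vz].
    exact: (smooth_map_at_trivialization_inv sX sG sQ a_smooth ss).
  + by move=> y Vy.
  + by move=> z [_ Vz] /=; rewrite orbit_proj_act sKV.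
  + by move=> y Vy; exact: (act_chi sKV).
  + move=> [g y] [_ Vy] /=.
    by congr pair; [exact: (chi_act a_free sKV)|rewrite orbit_proj_act sKV].
- move=> g y Vy /=.
  by congr pair; [exact: (chi_actM a_free sKV)|exact: orbit_proj_act].
Qed.
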